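(* Any Kähler metric and any co-Kähler metric is a Fisher information metric. That is: let $M$ be a Kähler manifold with Kähler metric $g$, or a co-Kähler manifold with co-Kähler metric $g$. Then there exist a sample space $\Xi$ with a measure $dx$ and a parametric family $\{p_\theta:\theta\in M\}$ of positive probability density functions on $\Xi$ (with respect to $dx$), parametrized by $M$, such that $g$ is its Fisher information metric, i.e. in any local coordinates $(\theta^i)$ of $M$, $$g_{ij}(\theta)=\int_{\Xi}\frac{\partial\log p_\theta(x)}{\partial\theta^i}\frac{\partial\log p_\theta(x)}{\partial\theta^j}\,p_\theta(x)\,dx=4\int_{\Xi}\frac{\partial\sqrt{p_\theta(x)}}{\partial\theta^i}\frac{\partial\sqrt{p_\theta(x)}}{\partial\theta^j}\,dx .$$
   Context: A co-Kähler manifold is $(M^{2d+1},\Omega,\alpha)$ with $\Omega$ a closed 2-form, $\alpha$ a closed 1-form, $\alpha\wedge\Omega^d$ nowhere zero, admitting a compatible almost contact metric structure $(\Theta,E,\alpha,g)$ with $N^{\Theta}=0$. Here $E$ is the vector field with $i_E\Omega=0$, $i_E\alpha=1$; $\Theta$ is an endomorphism field of $TM$ and $g$ a Riemannian metric with $\Theta^2=-I+\alpha\otimes E$, $\Theta E=0$, $\alpha\circ\Theta=0$, $\alpha=g(\cdot,E)$, $g=\Omega(\cdot,\Theta\cdot)+\alpha\otimes\alpha$; and $N^{\Theta}(X,Y)=[\Theta X,\Theta Y]-\Theta[\Theta X,Y]-\Theta[X,\Theta Y]+\Theta^2[X,Y]$. The metric $g$ of such a structure is called a co-Kähler metric. 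*)

(* Defs.v *)
From mathcomp Require Import all_boot all_order all_algebra all_fingroup.
From mathcomp Require Import all_classical all_reals all_analysis.

Set Implicit Arguments.
Unset Strict Implicit.
Unset Printing Implicit Defensive.

Import Order.TTheory GRing.Theory Num.Theory.
Import numFieldNormedType.Exports.

Local Open Scope classical_set_scope.
Local Open Scope ring_scope.

(** * Smooth manifolds *)

Section Smooth.
Variables (R : realType) (n : nat).

Definition partial (i : 'I_n) (f : 'rV[R]_n -> R) : 'rV[R]_n -> R :=
  fun x => 'D_(delta_mx 0 i) f x.

(* f is infinitely (Frechet) differentiable on the open set U *)
Definition smooth_on (U : set 'rV[R]_n) (f : 'rV[R]_n -> R) : Prop :=
  forall (s : seq 'I_n) (x : 'rV[R]_n), U x ->
    differentiable (foldr partial f s) x.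

(* A homeomorphism from an open subset of M onto an open subset of R^n; the
   values of chart_map and chart_inv outside those subsets are irrelevant. *)
Record chart (M : topologicalType) := Chart {
  chart_dom : set M ;
  chart_map : M -> 'rV[R]_n ;
  chart_inv : 'rV[R]_n -> M ;
  chart_dom_open : open chart_dom ;
  chart_cod_open : open (chart_map @` chart_dom) ;
  chart_mapK : forall p, chart_dom p -> chart_inv (chart_map p) = p ;
  chart_map_continuous : forall p, chart_dom p -> continuous_at p chart_map ;
  chart_inv_continuous : forall x, (chart_map @` chart_dom) x ->
    continuous_at x chart_inv }.

Definition chart_cod (M : topologicalType) (c : chart M) : set 'rV[R]_n :=
  chart_map c @` chart_dom c.

Definition smooth_transition (M : topologicalType) (c c' : chart M) : Prop :=
  forall j : 'I_n,
    smooth_on (chart_map c @` (chart_dom c `&` chart_dom c'))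
              (fun x => chart_map c' (chart_inv c x) 0 j).

Record smoothManifold := SmoothManifold {
  points :> topologicalType ;
  atlas : set (chart points) ;
  points_hausdorff : hausdorff_space points ;
  points_second_countable : @second_countable points ;
  atlas_cover : forall p : points, exists2 c, atlas c & chart_dom c p ;
  atlas_compatible : forall c c', atlas c -> atlas c' -> smooth_transition c c' ;
  atlas_maximal : forall c,
    (forall c', atlas c' -> smooth_transition c c' /\ smooth_transition c' c) ->
    atlas c }.

End Smooth.

(** * Tensor fields

  A tensor field is given by its components in every chart of the (maximal)
  atlas.  Tangent vectors at a point are row vectors of components, and:
  - an endomorphism A acts by u |-> u *m A;
  - a 1-form a (a column) has values (u *m a) 0 0;
  - a bilinear form B has values B(u, v) = (u *m B *m v^T) 0 0. *)

Section Fields.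
Variables (R : realType) (n : nat) (M : smoothManifold R n).

Definition smooth_function (f : M -> R) : Prop :=
  forall c, atlas c -> smooth_on (chart_cod c) (f \o chart_inv c).

Definition field (k l : nat) := chart R n M -> M -> 'M[R]_(k, l).

(* the expression of a field in the coordinates of c *)
Definition local (k l : nat) (T : field k l) (c : chart R n M)
  : 'rV[R]_n -> 'M[R]_(k, l) := fun x => T c (chart_inv c x).

Definition smooth_field (k l : nat) (T : field k l) : Prop :=
  forall c, atlas c -> forall i j,
    smooth_on (chart_cod c) (fun x => local T c x i j).

(* Entry (i, j) is the i-th partial derivative of the j-th coordinate of c'. *)
Definition transition_jacobian (c c' : chart R n M) (p : M) : 'M[R]_n :=
  'J (chart_map c' \o chart_inv c) (chart_map c p).

Definition on_overlaps (P : chart R n M -> chart R n M -> M -> Prop) : Prop :=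
  forall c c' p, atlas c -> atlas c' -> chart_dom c p -> chart_dom c' p ->
    P c c' p.

Definition everywhere (P : chart R n M -> M -> Prop) : Prop :=
  forall c p, atlas c -> chart_dom c p -> P c p.

Definition vector_field (X : field 1 n) : Prop :=
  smooth_field X /\
  on_overlaps (fun c c' p => X c' p = X c p *m transition_jacobian c c' p).

Definition covector_field (a : field n 1) : Prop :=
  smooth_field a /\
  on_overlaps (fun c c' p => a c p = transition_jacobian c c' p *m a c' p).

Definition bilinear_field (B : field n n) : Prop :=
  smooth_field B /\
  on_overlaps (fun c c' p => B c p =
    transition_jacobian c c' p *m B c' p *m (transition_jacobian c c' p)^T).

Definition endomorphism_field (A : field n n) : Prop :=
  smooth_field A /\
  on_overlaps (fun c c' p =>
    A c p *m transition_jacobian c c' p = transition_jacobian c c' p *m A c' p).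

Definition two_form (W : field n n) : Prop :=
  bilinear_field W /\ everywhere (fun c p => (W c p)^T = - W c p).

Definition riemannian_metric (g : field n n) : Prop :=
  [/\ bilinear_field g,
      everywhere (fun c p => (g c p)^T = g c p) &
      everywhere (fun c p => forall v : 'rV[R]_n, v != 0 ->
        0 < (v *m g c p *m v^T) 0 0)].

(* [X, Y] = D_X Y - D_Y X in coordinates *)
Definition bracket (X Y : field 1 n) : field 1 n := fun c p =>
  'D_(X c p) (local Y c) (chart_map c p)
  - 'D_(Y c p) (local X c) (chart_map c p).

Definition apply_endo (A : field n n) (X : field 1 n) : field 1 n :=
  fun c p => X c p *m A c p.

Definition nijenhuis (A : field n n) (X Y : field 1 n) : field 1 n :=
  fun c p =>
    bracket (apply_endo A X) (apply_endo A Y) c p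
    - apply_endo A (bracket (apply_endo A X) Y) c p
    - apply_endo A (bracket X (apply_endo A Y)) c p
    + apply_endo A (apply_endo A (bracket X Y)) c p.

Definition nijenhuis_vanishes (A : field n n) : Prop :=
  forall X Y, vector_field X -> vector_field Y ->
    everywhere (fun c p => nijenhuis A X Y c p = 0).

End Fields.

(** * Exterior algebra and closed forms *)

Section Forms.
Variables (R : realType) (n : nat).

Definition form (k : nat) := ('I_k -> 'rV[R]_n) -> R.

Definition form1 (a : 'cV[R]_n) : form 1 := fun v => (v ord0 *m a) 0 0.

Definition form2 (W : 'M[R]_n) : form 2 :=
  fun v => (v ord0 *m W *m (v ord_max)^T) 0 0.

Definition wedge (k l : nat) (eta : form k) (zeta : form l) : form (k + l) :=
  fun v => (k`! * l`!)%:R^-1 *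
    \sum_(s : 'S_(k + l)) (-1) ^+ s *
      (eta (fun i => v (s (lshift l i))) * zeta (fun j => v (s (rshift k j)))).

Fixpoint wedge_pow2 (eta : form 2) (d : nat) : form (d * 2) :=
  match d with
  | 0 => fun=> 1
  | e.+1 => wedge eta (wedge_pow2 (d := e) eta)
  end.

(* The exterior derivative of a k-form on an open subset of R^n, evaluated on
   constant vector fields, for which the bracket terms vanish. *)
Definition ext_deriv (k : nat) (eta : 'rV[R]_n -> form k) (x : 'rV[R]_n)
  : form k.+1 :=
  fun v => \sum_(i < k.+1)
    (-1) ^+ i * 'D_(v i) (fun y => eta y (fun j : 'I_k => v (lift i j))) x.

Variable M : smoothManifold R n.

Definition closed1 (a : field M n 1) : Prop :=
  everywhere (fun c p => forall v,
    ext_deriv (fun x => form1 (local a c x)) (chart_map c p) v = 0).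

Definition closed2 (W : field M n n) : Prop :=
  everywhere (fun c p => forall v,
    ext_deriv (fun x => form2 (local W c x)) (chart_map c p) v = 0).

End Forms.

(** * Kähler and co-Kähler metrics *)

Definition kahler_structure (R : realType) (d : nat)
    (M : smoothManifold R (d * 2)) (w J g : field M (d * 2) (d * 2)) : Prop :=
  [/\ two_form w /\ closed2 w,
      everywhere (fun c p => w c p \in unitmx),
      endomorphism_field J /\ everywhere (fun c p => J c p *m J c p = - 1%:M),
      riemannian_metric g /\ everywhere (fun c p => g c p = w c p *m (J c p)^T)
    & nijenhuis_vanishes J].

Definition kahler_metric (R : realType) (d : nat)
    (M : smoothManifold R (d * 2)) (g : field M (d * 2) (d * 2)) : Prop :=
  exists w J, kahler_structure w J g.

Section CoKahler.
Variables (R : realType) (d : nat).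
Local Notation n := (1 + d * 2)%N.
Variable M : smoothManifold R n.

Definition almost_cosymplectic (W : field M n n) (a : field M n 1) : Prop :=
  [/\ two_form W /\ closed2 W,
      covector_field a /\ closed1 a
    & everywhere (fun c p =>
        exists v, wedge (form1 (a c p)) (wedge_pow2 (d := d) (form2 (W c p))) v != 0)].

Definition reeb_field (W : field M n n) (a : field M n 1) (E : field M 1 n)
  : Prop :=
  vector_field E /\
  everywhere (fun c p => E c p *m W c p = 0 /\ E c p *m a c p = 1%:M).

Definition compatible_contact_metric (W : field M n n) (a : field M n 1)
    (E : field M 1 n) (A g : field M n n) : Prop :=
  [/\ endomorphism_field A, riemannian_metric g
    & everywhere (fun c p =>
        [/\ A c p *m A c p = - 1%:M + a c p *m E c p,
            E c p *m A c p = 0,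
            A c p *m a c p = 0,
            a c p = g c p *m (E c p)^T
          & g c p = W c p *m (A c p)^T + a c p *m (a c p)^T])].

Definition cokahler_metric (g : field M n n) : Prop :=
  exists W a E A,
    [/\ almost_cosymplectic W a, reeb_field W a E,
        compatible_contact_metric W a E A g & nijenhuis_vanishes A].

End CoKahler.

(** * Fisher information metrics *)

Section Fisher.
Variables (R : realType) (n : nat) (M : smoothManifold R n).
Variables (disp : measure_display) (Xi : measurableType disp).
Variable mu : {measure set Xi -> \bar R}.

Definition density_family (p : M -> Xi -> R) : Prop :=
  [/\ forall t x, 0 < p t x,
      forall t, measurable_fun setT (p t),
      forall t, (\int[mu]_x (p t x)%:E = 1)%E
    & forall x, smooth_function (fun t => p t x)].

(* i-th partial derivative of h in the coordinates of c, at t *)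
Definition chart_partial (c : chart R n M) (i : 'I_n) (h : M -> R) (t : M) : R :=
  partial i (h \o chart_inv c) (chart_map c t).

Definition fisher_log (p : M -> Xi -> R) (c : chart R n M) (t : M) (i j : 'I_n)
  : Xi -> R := fun x =>
  chart_partial c i (fun u => ln (p u x)) t *
  chart_partial c j (fun u => ln (p u x)) t * p t x.

Definition fisher_sqrt (p : M -> Xi -> R) (c : chart R n M) (t : M) (i j : 'I_n)
  : Xi -> R := fun x =>
  chart_partial c i (fun u => Num.sqrt (p u x)) t *
  chart_partial c j (fun u => Num.sqrt (p u x)) t.

Definition fisher_metric_of (p : M -> Xi -> R) (g : field M n n) : Prop :=
  everywhere (fun c t => forall i j,
    [/\ mu.-integrable setT (EFin \o fisher_log p c t i j),
        mu.-integrable setT (EFin \o fisher_sqrt p c t i j),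
        ((g c t i j)%:E = \int[mu]_x (fisher_log p c t i j x)%:E)%E
      & ((g c t i j)%:E = 4%:E * \int[mu]_x (fisher_sqrt p c t i j x)%:E)%E]).

End Fisher.

Definition fisher_information_metric (R : realType) (n : nat)
    (M : smoothManifold R n) (g : field M n n) : Prop :=
  exists (disp : measure_display) (Xi : measurableType disp)
         (mu : {measure set Xi -> \bar R}) (p : M -> Xi -> R),
    density_family mu p /\ fisher_metric_of mu p g.

(* Main.v *)
Require Import Defs.
From HB Require Import structures.
From mathcomp Require Import all_boot all_order all_algebra.
From mathcomp Require Import finmap.
From mathcomp Require Import all_classical all_reals all_analysis.
From mathcomp Require Import ring lra.

Set Implicit Arguments.
Unset Strict Implicit.
Unset Printing Implicit Defensive.

Import Order.TTheory GRing.Theory Num.Theory.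
Import numFieldNormedType.Exports.

Local Open Scope classical_set_scope.
Local Open Scope ring_scope.

(** The theorem is an instance of a fact of Riemannian geometry: every Riemannian
    metric [g] is a Fisher information metric. The sample space is the set of all
    smooth functions [s] on [M] with [|s| <= 1/2], and the density at the point
    [t] is [s |-> 1 + s t]; the metric [g] is encoded in the measure. If this
    measure is a sum of point masses [w] at finitely many samples whose sum is
    zero, plus another such sum, and so on, then the total mass of the densities
    is the sum of the masses, and the Fisher metric is the sum of the terms
    [w ds^2 / (1 + s)].
    So it has to be shown that [g] is a sum of such terms, the total mass being
    one. No isometric embedding theorem is needed, because infinitely many
    functions [s] are available and the sum has to converge only pointwise.

    The terms are found greedily. The remainder [h], which starts as [g], stays
    continuous and positive definite, and one round removes from it a sum of
    terms [T <= h / 2] with [T >= h / 64] on a prescribed compact subset [K] of a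
    chart, for an arbitrarily small total mass ([local_round], transported to
    [M] in [global_round]). Countably many such compact sets cover [M]; if each
    of them is treated infinitely often, the remainder tends to zero at every
    point ([metric_exhaustion]).

    A round goes as follows. Around a point [x] the form [h] lies within a factor
    2 of the constant form [h x], which is a sum of squares of linear forms [l].
    With a cut-off [psi], a small amplitude [a] and a large frequency [lam], the
    functions [a psi cos (lam l)] and [a psi sin (lam l)] have differentials whose
    squares add up to [a^2 lam^2 psi^2 l^2 + a^2 dpsi^2]; when [a lam] is fixed by
    the mass and [lam] grows, the functions become small and the second term
    becomes negligible ([corrugation]). The cut-offs for a finite cover of [K]
    are chosen so that the sum of their squares is between 3/4 and 1 on [K],
    whatever the number of windows ([windows_cover]): this is what makes the
    proportion 1/64 the same in all rounds.

    Pointwise, the Fisher integrals are first computed on the diagonal, where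
    they are sums of nonnegative terms, and then obtained by polarization
    ([continuous_metric_fisher]). *)

(** * Calculus of smooth functions *)

Section SmoothCalculus.
Variables (R : realType) (n : nat).
Implicit Types (U : set 'rV[R]_n) (f g : 'rV[R]_n -> R).

Lemma partialE f x i :
  differentiable f x -> partial i f x = 'd f x (delta_mx 0 i).
Proof. by move=> df; rewrite /partial deriveE. Qed.

Lemma smooth_on_differentiable U f x :
  smooth_on U f -> U x -> differentiable f x.
Proof. by move=> sf Ux; exact: (sf [::]). Qed.

Lemma smooth_on_partial U f i : smooth_on U f -> smooth_on U (partial i f).
Proof.
by move=> sf s x Ux; rewrite -(foldr_rcons (@partial R n) f s i); exact: sf.
Qed.

Lemma near_eq_partial f g x i :
  {near x, f =1 g} -> partial i f x = partial i g x.
Proof.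
by move=> fg; exact: near_eq_derive.
Qed.

Lemma near_eq_differentiable f g x :
  {near x, f =1 g} -> differentiable f x -> differentiable g x.
Proof.
move=> fg df; have fgx : f x = g x := nbhs_singleton fg.
have [dfc /eqaddoP dff] := (diff_locallyP x f).1 df.
have dg : g \o shift x = cst (g x) + 'd f x +o_ 0 id.
  apply/eqaddoP => e e0; have := dff e e0.
  have : \forall h \near (0 : 'rV[R]_n), f (h + x) = g (h + x).
    have hx : (fun h : 'rV[R]_n => h + x) @ (0 : 'rV[R]_n) --> x.
      rewrite -[X in _ --> X]add0r.
      apply: (@cvgD _ _ _ _ (nbhs_filter (0 : 'rV[R]_n)) id (cst x) 0 x).
        exact: cvg_id.
      exact: cvg_cst.
    exact: hx fg.
  apply: filterS2 => h fgh; rewrite /= !fctE /= fgh fgx //.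
have gE : 'd g x = 'd f x :> (_ -> _) by apply: diff_unique.
by apply/diff_locallyP; rewrite gE.
Qed.

Lemma eq_smooth_on U f g :
  open U -> (forall x, U x -> f x = g x) -> smooth_on U f -> smooth_on U g.
Proof.
move=> oU fg sf s x Ux; have nU y (Uy : U y) : \forall z \near y, U z.
  exact: open_nbhs_nbhs.
have eqs : forall y, U y -> foldr (@partial R n) f s y = foldr (@partial R n) g s y.
  elim: s => [|i s IH] //= y Uy; apply: near_eq_partial.
  by near=> z; apply: IH; near: z; exact: nU.
apply: (@near_eq_differentiable (foldr (@partial R n) f s)); last exact: sf.
by near=> z; apply: eqs; near: z; exact: nU.
Unshelve. all: by end_near. Qed.

(** Coinduction for smoothness: iterated partial derivatives never leave the
    class [C], and all its members are differentiable. *)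
Lemma smooth_on_coind U (C : set ('rV[R]_n -> R)) : open U ->
  (forall f, C f -> (forall x, U x -> differentiable f x) /\
     forall i, exists2 g, C g & forall x, U x -> partial i f x = g x) ->
  forall f, C f -> smooth_on U f.
Proof.
move=> oU HC f Cf s; elim/last_ind: s f Cf => [|s i IH] f Cf x Ux.
  by have [+ _] := HC f Cf; apply.
rewrite foldr_rcons; have [_ /(_ i) [g Cg fg]] := HC f Cf.
have nU y (Uy : U y) : \forall z \near y, U z by exact: open_nbhs_nbhs.
have eqs : forall y, U y ->
    foldr (@partial R n) (partial i f) s y = foldr (@partial R n) g s y.
  elim: (s) => [|j t IHt] /= y Uy; first exact: fg.
  apply: near_eq_partial.
  by near=> z; apply: IHt; near: z; exact: nU.
apply: (@near_eq_differentiable (foldr (@partial R n) g s)); last exact: IH.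
by near=> z; apply/esym/eqs; near: z; exact: nU.
Unshelve. all: by end_near. Qed.

End SmoothCalculus.

(** The whole sequence of derivatives is given, so that the chain rule can be
    iterated without computing them. *)
Definition smooth1 (R : realType) (F : R -> R) : Prop :=
  exists2 Fs : nat -> R -> R, F = Fs 0%N &
    forall (k : nat) (x : R), is_derive x 1 (Fs k) (Fs k.+1 x).

Section SmoothExpressions.
Variables (R : realType) (n : nat).
Implicit Types (U : set 'rV[R]_n) (f g : 'rV[R]_n -> R).

Lemma partialD f g x i : differentiable f x -> differentiable g x ->
  partial i (fun y => f y + g y) x = partial i f x + partial i g x.
Proof.
move=> df dg; rewrite !partialE//; last exact: differentiableD.
by rewrite (@diffD _ _ _ f g x).
Qed.

Lemma partialM f g x i : differentiable f x -> differentiable g x ->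
  partial i (fun y => f y * g y) x = f x * partial i g x + g x * partial i f x.
Proof.
move=> df dg; rewrite !partialE//; last exact: differentiableM.
by rewrite (@diffM _ _ f g x).
Qed.

Lemma differentiable_comp1 (F : R -> R) (F' : R) f x :
  is_derive (f x) 1 F F' -> differentiable f x ->
  differentiable (fun y => F (f y)) x.
Proof.
move=> dF df; apply: (@differentiable_comp _ _ _ _ f F) => //.
by apply/derivable1_diffP; exact: ex_derive.
Qed.

Lemma partial_comp1 (F : R -> R) (F' : R) f x i :
  is_derive (f x) 1 F F' -> differentiable f x ->
  partial i (fun y => F (f y)) x = F' * partial i f x.
Proof.
move=> dF df; rewrite !partialE//; last exact: differentiable_comp1 dF df.
have dF1 : derivable F (f x) 1 by exact: ex_derive.
rewrite (@diff_comp _ _ _ _ f F)//=; last exact/derivable1_diffP.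
by rewrite deriv1E//= derive1E derive_val mulrC.
Qed.

Lemma differentiable_row (m : nat) (phi : 'rV[R]_n -> 'rV[R]_m) x :
  (forall j, differentiable (fun y => phi y 0 j) x) -> differentiable phi x.
Proof.
move=> dphi.
have -> : phi = (fun y => \sum_(j < m) phi y 0 j *: (delta_mx 0 j : 'rV_m)).
  by apply/funext => y; exact: row_sum_delta.
rewrite -[X in differentiable X _]fct_sumE.
apply: differentiable_sum => j; exact: differentiableZl.
Qed.

Lemma diff_row_coord (m : nat) (phi : 'rV[R]_n -> 'rV[R]_m) x v j :
  differentiable phi x -> 'd phi x v 0 j = 'd (fun y => phi y 0 j) x v.
Proof.
move=> dphi; rewrite -!deriveE//; last first.
  apply: (@differentiable_comp _ _ _ _ phi (fun u : 'rV[R]_m => u 0 j)) => //.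
  exact: differentiable_coord.
by rewrite derive_mx ?mxE//; exact: diff_derivable.
Qed.

Lemma partial_comp (m : nat) (F : 'rV[R]_m -> R) (phi : 'rV[R]_n -> 'rV[R]_m) x i :
  differentiable F (phi x) -> (forall j, differentiable (fun y => phi y 0 j) x) ->
  partial i (fun y => F (phi y)) x =
  \sum_(j < m) partial j F (phi x) * partial i (fun y => phi y 0 j) x.
Proof.
move=> dF dphi; have dphi' := differentiable_row dphi.
rewrite partialE; last exact: (@differentiable_comp _ _ _ _ phi F).
rewrite (@diff_comp _ _ _ _ phi F)//=.
rewrite [X in 'd F _ X]row_sum_delta linear_sum; apply: eq_bigr => j _.
by rewrite linearZ /= diff_row_coord// !partialE// mulrC.
Qed.

(** A syntax for building smooth functions. The rules of differentiation show
    that the class is stable under partial derivatives, hence that its members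
    are smooth by [smooth_on_coind]: this treats sums, products and compositions
    of all orders at once. *)
Inductive smooth_expr U : ('rV[R]_n -> R) -> Prop :=
| SmoothBase f of smooth_on U f : smooth_expr U f
| SmoothAdd f g of smooth_expr U f & smooth_expr U g :
    smooth_expr U (fun x => f x + g x)
| SmoothMul f g of smooth_expr U f & smooth_expr U g :
    smooth_expr U (fun x => f x * g x)
| SmoothComp1 F f of smooth1 F & smooth_expr U f : smooth_expr U (fun x => F (f x))
| SmoothComp m (F : 'rV[R]_m -> R) (phi : 'rV[R]_n -> 'rV[R]_m)
    of smooth_on setT F & (forall j, smooth_expr U (fun x => phi x 0 j)) :
    smooth_expr U (fun x => F (phi x)).

Lemma smooth_expr_differentiable U f x :
  smooth_expr U f -> U x -> differentiable f x.
Proof.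
move=> sf Ux; elim: sf => {f}.
- by move=> f sf; exact: smooth_on_differentiable sf Ux.
- by move=> f g _ df _ dg; exact: differentiableD.
- by move=> f g _ df _ dg; exact: differentiableM.
- move=> F f [Fs -> Fd] _ df; exact: differentiable_comp1 (Fd _ _) df.
- move=> m F phi sF _ dphi; apply: (@differentiable_comp _ _ _ _ phi F).
    exact: differentiable_row.
  exact: smooth_on_differentiable sF _.
Qed.

Lemma smooth_expr_cst U c : open U -> smooth_expr U (fun _ => c).
Proof.
move=> oU; apply: SmoothBase.
apply: (@smooth_on_coind _ _ _ (fun f => exists c, f = fun=> c)) => //; last by exists c.
move=> _ [d ->]; split=> [x _|i]; first exact: differentiable_cst.
exists (fun=> 0); first by exists 0.
by move=> x _; rewrite /partial derive_cst.
Qed.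

Lemma smooth_expr_sum U (I : Type) (r : seq I) (f : I -> 'rV[R]_n -> R) :
  open U -> (forall i, smooth_expr U (f i)) ->
  smooth_expr U (fun x => \sum_(i <- r) f i x).
Proof.
move=> oU sf; elim: r => [|i r IH].
  rewrite (_ : (fun _ => _) = fun=> 0); first exact: smooth_expr_cst.
  by apply/funext => x; rewrite big_nil.
rewrite (_ : (fun _ => _) = fun x => f i x + \sum_(j <- r) f j x).
  exact: SmoothAdd.
by apply/funext => x; rewrite big_cons.
Qed.

Lemma smooth_expr_partial U f i : open U -> smooth_expr U f ->
  exists2 g, smooth_expr U g & forall x, U x -> partial i f x = g x.
Proof.
move=> oU sf; have dU := smooth_expr_differentiable; elim: sf => {f}.
- move=> f sf; exists (partial i f) => //; apply: SmoothBase.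
  exact: smooth_on_partial.
- move=> f g sf [f' sf' ff'] sg [g' sg' gg'].
  exists (fun x => f' x + g' x); first exact: SmoothAdd.
  by move=> x Ux; rewrite partialD ?ff' ?gg'//; exact: dU Ux.
- move=> f g sf [f' sf' ff'] sg [g' sg' gg'].
  exists (fun x => f x * g' x + g x * f' x).
    by apply: SmoothAdd; exact: SmoothMul.
  by move=> x Ux; rewrite partialM ?ff' ?gg'//; exact: dU Ux.
- move=> F f [Fs -> Fd] sf [f' sf' ff'].
  exists (fun x => Fs 1%N (f x) * f' x).
    apply: SmoothMul => //; apply: SmoothComp1 => //.
    by exists (fun k => Fs k.+1).
  move=> x Ux; rewrite (partial_comp1 _ (Fd _ _)) ?ff'//; exact: dU Ux.
- move=> m F phi sF sphi dphi.
  pose phi' j : 'rV[R]_n -> R := sval (cid2 (dphi j)).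
  exists (fun x => \sum_(j < m) partial j F (phi x) * phi' j x).
    apply: smooth_expr_sum => // j; apply: SmoothMul.
      by apply: SmoothComp => //; exact: smooth_on_partial.
    by rewrite /phi'; case: cid2.
  move=> x Ux; rewrite partial_comp; first last.
  + by move=> j; exact: dU Ux.
  + exact: smooth_on_differentiable sF _.
  by apply: eq_bigr => j _; rewrite /phi'; case: cid2 => /= h _ ->.
Qed.

Lemma smooth_expr_smooth U f : open U -> smooth_expr U f -> smooth_on U f.
Proof.
move=> oU; apply: (@smooth_on_coind _ _ _ (smooth_expr U)) => // {}f sf.
split=> [x Ux|i]; first exact: smooth_expr_differentiable Ux.
exact: smooth_expr_partial.
Qed.

Lemma smooth_on_coord U j : open U -> smooth_on U (fun x => x 0 j).
Proof.
move=> oU.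
apply: (@smooth_on_coind _ _ _ (fun f =>
  f = (fun x => x 0 j) \/ exists c, f = fun=> c)) => //; last by left.
move=> _ [->|[c ->]]; split=> [x _|i].
- exact: differentiable_coord.
- exists (fun=> (delta_mx 0 i : 'rV[R]_n) 0 j).
    by right; exists ((delta_mx 0 i : 'rV[R]_n) 0 j).
  move=> x _; rewrite partialE; last exact: differentiable_coord.
  by rewrite -(@diff_row_coord _ id)// diff_val.
- exact: differentiable_cst.
- by exists (fun=> 0); [right; exists 0|move=> x _; rewrite /partial derive_cst].
Qed.

End SmoothExpressions.

(** * Smooth functions of one variable *)

Section Smooth1.
Variable R : realType.

Lemma smooth1_cos_shift (c : R) : smooth1 (fun x : R => cos (x + c)).
Proof.
exists (fun k x => cos (x + c + k%:R * (pi / 2))).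
  by apply/funext => x; rewrite mul0r addr0.
move=> k x.
have -> : cos (x + c + k.+1%:R * (pi / 2)) = - sin (x + c + k%:R * (pi / 2)) :> R.
  by rewrite -cosDpihalf -natr1 mulrDl mul1r !addrA.
have -> : (fun y : R => cos (y + c + k%:R * (pi / 2))) =
          cos \o (fun y => y + (c + k%:R * (pi / 2))).
  by apply/funext => y /=; rewrite addrA.
have dD : is_derive x 1 (fun y : R => y + (c + k%:R * (pi / 2))) 1.
  by apply: is_derive_eq; rewrite addr0.
rewrite -[X in is_derive _ _ _ X]mulr1 -addrA.
by apply: is_derive1_comp.
Qed.

Lemma smooth1_cos : smooth1 (@cos R).
Proof.
rewrite (_ : cos = fun x : R => cos (x + 0)); first exact: smooth1_cos_shift.
by apply/funext => x; rewrite addr0.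
Qed.

Lemma smooth1_sin : smooth1 (@sin R).
Proof.
rewrite (_ : sin = fun x : R => cos (x + - (pi / 2))).
  exact: smooth1_cos_shift.
by apply/funext => x; rewrite cosBpihalf.
Qed.

(** The polynomial factor is there because the derivatives of the flat function
    [exp(-1/x)] are of this form. *)
Definition flat (P : {poly R}) (x : R) : R :=
  if 0 < x then P.[x^-1] * expR (- x^-1) else 0.

(** The monomial of degree [i] is dominated by means of the term of degree
    [i + 2] in the series of the exponential. *)
Lemma poly_expRN_bound (P : {poly R}) :
  exists C, forall y : R, 0 < y -> `|P.[y] * expR (- y)| <= C / y ^+ 2.
Proof.
exists (\sum_(i < size P) `|P`_i| * (i.+2)`!%:R) => y y0.
rewrite horner_coef big_distrl /= mulr_suml.
apply: le_trans (ler_norm_sum _ _ _) _; apply: ler_sum => i _.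
rewrite !normrM normrX (gtr0_norm y0) (gtr0_norm (expR_gt0 _)) -!mulrA.
apply: ler_wpM2l => //; rewrite ler_pdivlMr ?exprn_gt0//.
rewrite mulrAC -exprD addn2 expRN ler_pdivrMr ?expR_gt0//.
rewrite -ler_pdivrMl ?ltr0n ?fact_gt0// mulrC.
by apply: le_trans (expR_ge1Dxn i.+1 (ltW y0)); rewrite lerDr.
Qed.

Lemma flat_bound P : exists2 C, 0 <= C & forall x, `|flat P x| <= C * x ^+ 2.
Proof.
have [C HC] := poly_expRN_bound P.
have C0 : 0 <= C.
  have := HC 1 ltr01; rewrite expr1n divr1; exact: le_trans.
exists C => // x; rewrite /flat; case: ifPn => [x0|_].
  by have := HC x^-1; rewrite invr_gt0 exprVn invrK; apply.
by rewrite normr0 mulr_ge0// sqr_ge0.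
Qed.

Lemma is_derive_flat P (x : R) :
  is_derive x 1 (flat P) (flat ('X^2 * (P - P^`())) x).
Proof.
have [x0|x0|<-] := ltgtP 0 x.
- rewrite [flat _ x]/flat x0.
  have xn0 : x != 0 by rewrite gt_eqF.
  have dV : is_derive x 1 (fun y : R => y^-1) (- x^-1 ^+ 2).
    have -> : - x^-1 ^+ 2 = - x ^- 2 *: 1 by rewrite exprVn [RHS]mulr1.
    exact: is_deriveV.
  have dP : is_derive x 1 (fun y : R => P.[y^-1]) (- x^-1 ^+ 2 * P^`().[x^-1]).
    by rewrite mulrC; apply: (@is_derive1_comp _ (horner P) (fun y : R => y^-1)).
  have dE : is_derive x 1 (fun y : R => expR (- y^-1)) (x^-1 ^+ 2 * expR (- x^-1)).
    have -> : x^-1 ^+ 2 * expR (- x^-1) = expR (- x^-1) * - (- x^-1 ^+ 2).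
      by rewrite opprK mulrC.
    by apply: (@is_derive1_comp _ (@expR R) (fun y : R => - y^-1)).
  have dPE := is_deriveM dP dE.
  have -> : ('X^2 * (P - P^`())).[x^-1] * expR (- x^-1) =
    P.[x^-1] *: (x^-1 ^+ 2 * expR (- x^-1)) +
      expR (- x^-1) *: (- x^-1 ^+ 2 * P^`().[x^-1]).
    by rewrite !hornerE /= /GRing.scale /=; ring.
  apply: near_eq_is_derive dPE; near=> y.
  have y0 : 0 < y by near: y; exact: lt_nbhsr.
  by rewrite /flat y0.
- rewrite [flat _ x]/flat ltNge (ltW x0) /=.
  apply: (@near_eq_is_derive _ _ _ (cst 0)); near=> y.
  have y0 : y < 0 by near: y; exact: lt_nbhsl.
  by rewrite /flat ltNge (ltW y0).
- rewrite [flat _ 0]/flat ltxx.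
  have [C C0 HC] := flat_bound P.
  have lim0 : (fun h : R => h^-1 *: (flat P (h *: 1 + 0) - flat P 0)) @ 0^' --> (0 : R).
    have f0 : flat P 0 = 0 by rewrite /flat ltxx.
    rewrite f0; apply/cvgrPdist_le => e e0.
    have C1 : 0 < C + 1 by rewrite ltr_wpDl.
    near=> h; rewrite sub0r normrN subr0 addr0 normrM [h *: 1]mulr1.
    have h0 : h != 0 by near: h; exact: nbhs_dnbhs_neq.
    rewrite normrV ?unitfE// mulrC ler_pdivrMr ?normr_gt0//.
    apply: le_trans (HC h) _.
    rewrite -[h ^+ 2]ger0_norm ?sqr_ge0// normrX expr2 mulrA ler_wpM2r//.
    rewrite (@le_trans _ _ ((C + 1) * `|h|)) ?ler_wpM2r ?lerDl//.
    rewrite mulrC -ler_pdivlMr//.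
    by near: h; apply: dnbhs0_le; rewrite divr_gt0.
  by apply: DeriveDef; [apply/cvg_ex; exists 0|exact/cvg_lim].
Unshelve. all: by end_near. Qed.

Lemma smooth1_flat : smooth1 (flat 1).
Proof.
exists (fun k => flat (iter k (fun P => 'X^2 * (P - P^`())) 1)) => // k x.
exact: is_derive_flat.
Qed.

Lemma flat_le0 P x : x <= 0 -> flat P x = 0.
Proof. by move=> x0; rewrite /flat ltNge x0. Qed.

Lemma flat1_neq0 : flat 1 1 != 0.
Proof. by rewrite /flat ltr01 hornerE mul1r expR_eq0. Qed.

End Smooth1.

(** * Quadratic forms *)

Section QuadraticForms.
Variables (R : realType) (n : nat).
Implicit Types (A B : 'M[R]_n) (u v : 'rV[R]_n) (c : 'cV[R]_n).

Definition bil A u v : R := (u *m A *m v^T) 0 0.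
Definition quad A v : R := bil A v v.

Definition posdef A : Prop := A^T = A /\ forall v, v != 0 -> 0 < quad A v.

Lemma bilDl A u u' v : bil A (u + u') v = bil A u v + bil A u' v.
Proof. by rewrite /bil !mulmxDl mxE. Qed.

Lemma bilDr A u v v' : bil A u (v + v') = bil A u v + bil A u v'.
Proof. by rewrite /bil linearD /= mulmxDr mxE. Qed.

Lemma bilZl A a u v : bil A (a *: u) v = a * bil A u v.
Proof. by rewrite /bil -!scalemxAl mxE. Qed.

Lemma bilZr A a u v : bil A u (a *: v) = a * bil A u v.
Proof. by rewrite /bil linearZ /= -scalemxAr mxE. Qed.

Lemma bilE A i j : bil A (delta_mx 0 i) (delta_mx 0 j) = A i j.
Proof. by rewrite /bil -rowE trmx_delta -colE !mxE. Qed.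

Lemma bil_expand A u v : bil A u v = \sum_i \sum_j u 0 i * A i j * v 0 j.
Proof.
rewrite /bil mxE exchange_big /=; apply: eq_bigr => j _.
by rewrite mxE big_distrl /=; apply: eq_bigr => i _; rewrite mxE.
Qed.

Lemma bilC A u v : A^T = A -> bil A u v = bil A v u.
Proof.
move=> As; have Aij i j : A i j = A j i by rewrite -{1}As mxE.
rewrite !bil_expand exchange_big; apply: eq_bigr => i _; apply: eq_bigr => j _.
by rewrite Aij mulrC mulrA [_ * u _ _]mulrC mulrC mulrA [v _ _ * _]mulrC; ring.
Qed.

Lemma quadD A B v : quad (A + B) v = quad A v + quad B v.
Proof. by rewrite /quad /bil mulmxDr mulmxDl mxE. Qed.

Lemma quadN A v : quad (- A) v = - quad A v.
Proof. by rewrite /quad /bil mulmxN mulNmx mxE. Qed.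

Lemma quadB A B v : quad (A - B) v = quad A v - quad B v.
Proof. by rewrite quadD quadN. Qed.

Lemma quadZ a A v : quad (a *: A) v = a * quad A v.
Proof. by rewrite /quad /bil -scalemxAr -scalemxAl mxE. Qed.

Lemma quad0 v : quad 0 v = 0.
Proof. by rewrite /quad /bil mulmx0 mul0mx mxE. Qed.

Lemma quad_sum (I : Type) (r : seq I) (F : I -> 'M[R]_n) v :
  quad (\sum_(i <- r) F i) v = \sum_(i <- r) quad (F i) v.
Proof.
by elim: r => [|i r IH]; rewrite ?big_nil ?quad0// !big_cons quadD IH.
Qed.

Lemma quad_rank1 c v : quad (c *m c^T) v = ((v *m c) 0 0) ^+ 2.
Proof.
rewrite /quad /bil mulmxA -mulmxA -trmx_mul mxE big_ord1 [X in _ * X]mxE.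
by rewrite expr2.
Qed.

Lemma quad_add A u v : A^T = A ->
  quad A (u + v) = quad A u + 2 * bil A u v + quad A v.
Proof.
by move=> As; rewrite /quad bilDl !bilDr (bilC v u As); ring.
Qed.

(** The discriminant of the nonnegative polynomial [t |-> quad A (u + t v)]. *)
Lemma bil_CauchySchwarz A u v : A^T = A -> (forall v, 0 <= quad A v) ->
  bil A u v ^+ 2 <= quad A u * quad A v.
Proof.
move=> As A0.
have key t : 0 <= quad A u + 2 * t * bil A u v + t ^+ 2 * quad A v.
  have := A0 (u + t *: v); rewrite quad_add// bilZr /quad bilZl bilZr.
  by rewrite mulrA expr2 mulrA.
have [qv0|qv0] := eqVneq (quad A v) 0.
  have [b0|b0] := eqVneq (bil A u v) 0.
    by rewrite b0 expr0n mulr_ge0.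
  have := key (- (quad A u + 1) / (2 * bil A u v)).
  rewrite qv0 mulr0 addr0.
  rewrite (_ : 2 * _ * _ = - (quad A u + 1)); last by field.
  by rewrite opprD addNKr oppr_ge0 ler10.
have qv : 0 < quad A v by rewrite lt_neqAle eq_sym qv0 A0.
have := key (- bil A u v / quad A v).
rewrite (_ : _ + _ + _ = (quad A u * quad A v - bil A u v ^+ 2) / quad A v); last first.
  by field.
by rewrite pmulr_lge0 ?invr_gt0// subr_ge0.
Qed.

Lemma posdef_ge0 A v : posdef A -> 0 <= quad A v.
Proof.
move=> [_ A0]; have [->|v0] := eqVneq v 0; last exact/ltW/A0.
by rewrite /quad /bil !mul0mx mxE.
Qed.

(** Completion of the square: with [c = A e_i / sqrt (A e_i, e_i)], what is left
    of [A] is nonnegative by the Cauchy-Schwarz inequality and has [e_i] in its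
    kernel. Older vectors of the kernel stay there, so that the step can be
    iterated along a basis. *)
Lemma complete_square A i : A^T = A -> (forall v, 0 <= quad A v) ->
  exists c, [/\ (A - c *m c^T)^T = A - c *m c^T,
    forall v, 0 <= quad (A - c *m c^T) v,
    forall u, u *m A = 0 -> u *m (A - c *m c^T) = 0 &
    (delta_mx 0 i : 'rV[R]_n) *m (A - c *m c^T) = 0].
Proof.
move=> As A0.
have symc c : (A - c *m c^T)^T = A - c *m c^T.
  by rewrite linearB /= trmx_mul trmxK As.
have Aii : quad A (delta_mx 0 i) = A i i by rewrite /quad bilE.
have [a0|a0] := eqVneq (A i i) 0.
  (* An isotropic vector of a nonnegative form is already in the kernel. *)
  exists 0; rewrite mul0mx subr0; split => //.
  apply/rowP => j; rewrite -rowE !mxE -bilE.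
  apply/eqP; rewrite -sqrf_eq0 eq_le sqr_ge0 andbT.
  by apply: le_trans (bil_CauchySchwarz _ _ As A0) _; rewrite Aii a0 mul0r.
have a_gt0 : 0 < A i i by rewrite lt_neqAle eq_sym a0 -Aii A0.
have s0 : Num.sqrt (A i i) != 0 by rewrite gt_eqF// sqrtr_gt0.
have s2 : Num.sqrt (A i i) ^+ 2 = A i i by rewrite sqr_sqrtr// ltW.
pose c : 'cV_n := (Num.sqrt (A i i))^-1 *: col i A.
have uc u : (u *m c) 0 0 = (Num.sqrt (A i i))^-1 * (u *m A) 0 i.
  by rewrite /c -scalemxAr mxE colE mulmxA -colE [in LHS]mxE.
exists c; split => // [v|u uA|].
- rewrite quadB quad_rank1 uc exprMn exprVn s2 subr_ge0 ler_pdivrMl//.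
  have := bil_CauchySchwarz v (delta_mx 0 i) As A0.
  rewrite Aii /bil trmx_delta -colE [X in X ^+ 2]mxE mulrC; exact.
- rewrite mulmxBr uA sub0r mulmxA (_ : u *m c = 0) ?mul0mx ?oppr0//.
  by apply/matrixP => x y; rewrite !ord1 uc uA !mxE mulr0.
- apply/rowP => j; rewrite -rowE !mxE big_ord1 !mxE.
  rewrite (_ : A j i = A i j); last by rewrite -[in LHS]As mxE.
  by rewrite mulrACA -expr2 exprVn s2 mulKf ?subrr.
Qed.

Lemma sum_of_squares A : A^T = A -> (forall v, 0 <= quad A v) ->
  exists2 l : seq 'cV[R]_n, size l = n & A = \sum_(c <- l) c *m c^T.
Proof.
have gen (s : seq 'I_n) : forall A, A^T = A -> (forall v, 0 <= quad A v) ->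
  exists2 l : seq 'cV[R]_n, size l = size s &
  (forall u, u *m A = 0 -> u *m (A - \sum_(c <- l) c *m c^T) = 0) /\
   forall i, i \in s -> (delta_mx 0 i : 'rV[R]_n) *m (A - \sum_(c <- l) c *m c^T) = 0.
  elim: s => [|i s IH] {}A As A0.
    by exists [::] => //; rewrite big_nil subr0.
  have [c [Bs B0 kB iB]] := complete_square i As A0.
  have [l sl [kl il]] := IH _ Bs B0.
  exists (c :: l); rewrite /= ?sl// big_cons opprD addrA.
  split=> [u /kB/kl //|j]; rewrite inE => /predU1P[->|/il//].
  exact: kl iB.
move=> As A0; have [l] := gen (enum 'I_n) A As A0.
rewrite size_enum_ord => sl [_ H]; exists l => //.
apply/eqP; rewrite -subr_eq0; apply/eqP/row_matrixP => i.
by rewrite rowE H ?mem_enum// row0.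
Qed.

(** A positive definite form controls the coordinates: the [i]-th coordinate is
    the scalar product with the vector dual to it. *)
Lemma posdef_coercive A : posdef A ->
  exists2 C, 0 < C & forall v i, v 0 i ^+ 2 <= C * quad A v.
Proof.
move=> Apd; have [As A0] := Apd.
have Au : A \in unitmx.
  rewrite -row_free_unit -kermx_eq0; apply/eqP/row_matrixP => i; rewrite row0.
  have : row i (kermx A) *m A = 0 by rewrite -row_mul mulmx_ker row0.
  move: (row i _) => u uA; apply/eqP/negP => /negP /A0.
  by rewrite /quad /bil uA mul0mx mxE ltxx.
(* The summand 1 only serves to make the constant positive when [n = 0]. *)
exists (1 + \sum_i quad A (delta_mx 0 i *m invmx A)).
  by rewrite ltr_pwDl ?ltr01// sumr_ge0// => i _; exact: posdef_ge0.
move=> v i; rewrite mulrDl mul1r mulr_suml (bigD1 i)//= addrCA ler_wpDr//.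
  rewrite addr_ge0 ?posdef_ge0// sumr_ge0// => j _.
  by rewrite mulr_ge0 ?posdef_ge0.
have := @bil_CauchySchwarz A (delta_mx 0 i *m invmx A) v As (fun v => posdef_ge0 v Apd).
by rewrite {1}/bil mulmxKV// -(rowE i v^T) (_ : row i v^T 0 0 = v 0 i) ?mxE//; exact.
Qed.

Lemma posdef_coercive2 A : posdef A ->
  exists2 C, 0 < C & forall v i j, `|v 0 i * v 0 j| <= C * quad A v.
Proof.
move=> /posdef_coercive[C C0 HC]; exists C => // v i j; rewrite normrM.
have [ij|ij] := leP `|v 0 i| `|v 0 j|.
  apply: le_trans (HC v j); rewrite -[_ ^+ 2]ger0_norm ?sqr_ge0// normrX expr2.
  exact: ler_wpM2r.
apply: le_trans (HC v i); rewrite -[_ ^+ 2]ger0_norm ?sqr_ge0// normrX expr2.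
by apply: ler_wpM2l => //; exact: ltW.
Qed.

(** Coordinatewise closeness to [A] gives closeness relatively to [A], since [A]
    controls the products of coordinates. *)
Lemma posdef_near A : posdef A -> exists2 d, 0 < d &
  forall B, (forall i j, `|B i j - A i j| <= d) ->
  forall v, quad A v <= 2 * quad B v /\ quad B v <= 2 * quad A v.
Proof.
move=> Apd; have [C C0 HC] := posdef_coercive2 Apd.
have N0 : 0 < 2 * C * (n * n).+1%:R by rewrite !mulr_gt0.
exists (2 * C * (n * n).+1%:R)^-1 => [|B HB v]; first by rewrite invr_gt0.
have q0 := posdef_ge0 v Apd.
have : `|quad (B - A) v| <= quad A v / 2.
  rewrite {1}/quad bil_expand.
  apply: (@le_trans _ _ (\sum_(i < n) \sum_(j < n)
    ((2 * C * (n * n).+1%:R)^-1 * (C * quad A v)))).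
    apply: le_trans (ler_norm_sum _ _ _) _; apply: ler_sum => i _.
    apply: le_trans (ler_norm_sum _ _ _) _; apply: ler_sum => j _.
    rewrite mulrAC mulrC normrM ler_pM// ?HC//.
    by rewrite !mxE; exact: HB.
  rewrite !sumr_const !card_ord -mulrnA -[leLHS]mulr_natl.
  rewrite [leLHS](_ : _ = (n * n)%:R / (n * n).+1%:R * (quad A v / 2)); last first.
    by field; rewrite gt_eqF// gt_eqF//= pnatr_eq0.
  rewrite ler_piMl ?divr_ge0// ler_pdivrMr ?ltr0n// mul1r ler_nat.
  exact: leqnSn.
rewrite quadB ler_distl => /andP[]; lra.
Qed.

End QuadraticForms.

(** * Bumps and windows in a Euclidean space *)

Section Bumps.
Variables (R : realType) (n : nat).
Implicit Types (U : set 'rV[R]_n) (f g : 'rV[R]_n -> R) (x y v : 'rV[R]_n).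
Implicit Types (h : 'rV[R]_n -> 'M[R]_n).

Lemma closed_ball_compact x (r : R) : compact [set y | `|y - x| <= r].
Proof.
apply: bounded_closed_compact.
  exists (`|x| + r); split=> [|M xrM y /= yr]; first exact: num_real.
  rewrite -[y](subrK x) (le_trans (ler_normD _ _))// addrC.
  by rewrite (le_trans _ (ltW xrM))// lerD2l.
rewrite (_ : mkset _ = closed_ball_ Num.Def.normr x r).
  exact: closed_closed_ball_.
by apply/seteqP; split=> y /=; rewrite distrC.
Qed.

Lemma smooth_on_continuous U f x : smooth_on U f -> U x -> {for x, continuous f}.
Proof.
by move=> sf Ux; apply: differentiable_continuous; exact: smooth_on_differentiable sf Ux.
Qed.

Lemma smooth_on_cst U c : open U -> smooth_on U (fun _ => c).
Proof. by move=> oU; apply: smooth_expr_smooth => //; exact: smooth_expr_cst. Qed.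

Lemma smooth_onM U f g : open U -> smooth_on U f -> smooth_on U g ->
  smooth_on U (fun x => f x * g x).
Proof.
move=> oU sf sg; apply: smooth_expr_smooth => //.
by apply: SmoothMul; exact: SmoothBase.
Qed.

Lemma smooth_on_comp1 U F f : open U -> smooth1 F -> smooth_on U f ->
  smooth_on U (fun x => F (f x)).
Proof.
move=> oU sF sf; apply: smooth_expr_smooth => //.
by apply: SmoothComp1 => //; exact: SmoothBase.
Qed.

(** The value [pi / 2] at the centre makes [sin eta] equal to 1 and [cos eta]
    vanish there, as needed in [windows_cover]. *)
Lemma exists_bump x (r : R) : 0 < r -> exists eta : 'rV[R]_n -> R,
  [/\ smooth_on setT eta, eta x = pi / 2 & forall y, r < `|y - x| -> eta y = 0].
Proof.
move=> r0.
pose rho y := 1 - \sum_i ((y 0 i - x 0 i) / r) ^+ 2.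
exists (fun y => (pi / 2 / flat 1 1) * flat 1 (rho y)); split.
- apply: smooth_expr_smooth; first exact: openT.
  apply: SmoothMul; first by apply: smooth_expr_cst; exact: openT.
  apply: SmoothComp1; first exact: smooth1_flat.
  rewrite (_ : rho = fun y => 1 + \sum_i (-1 *
    (((y 0 i + - x 0 i) * r^-1) * ((y 0 i + - x 0 i) * r^-1)))); last first.
    apply/funext => y; rewrite /rho -sumrN; congr (_ + _); apply: eq_bigr => i _.
    by rewrite expr2 mulN1r.
  apply: SmoothAdd; first by apply: smooth_expr_cst; exact: openT.
  apply: smooth_expr_sum => [|i]; first exact: openT.
  have scst c : smooth_expr [set: 'rV[R]_n] (fun=> c).
    by apply: smooth_expr_cst; exact: openT.
  have sc : smooth_expr [set: 'rV[R]_n] (fun y => (y 0 i + - x 0 i) * r^-1).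
    apply: SmoothMul => //; apply: SmoothAdd => //; apply: SmoothBase.
    by apply: smooth_on_coord; exact: openT.
  by apply: SmoothMul => //; exact: SmoothMul.
- rewrite /rho big1 ?subr0 ?divfK ?flat1_neq0// => i _.
  by rewrite subrr mul0r expr0n.
- move=> y ry; suff rho0 : rho y <= 0 by rewrite (flat_le0 _ rho0) mulr0.
  rewrite subr_le0.
  have : mx_norm (y - x) != 0 by rewrite gt_eqF// (lt_trans r0).
  move=> /mx_norm_neq0[[j i] /= normE].
  rewrite (bigD1 i)//= ler_wpDr ?sumr_ge0// => [k _|]; first exact: sqr_ge0.
  rewrite -[leRHS]ger0_norm ?sqr_ge0// normrX normrM normfV (gtr0_norm r0).
  rewrite exprn_ege1// ler_pdivlMr// mul1r.
  have := ltW ry; rewrite {1}/Num.Def.normr /= normE ord1 !mxE; exact.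
Qed.

(** A cut-off [psi] supported where the variable form [h] can be replaced by the
    frozen form [h x] at the price of a factor 2. *)
Definition window U (h : 'rV[R]_n -> 'M[R]_n) x (psi : 'rV[R]_n -> R) : Prop :=
  [/\ U x, smooth_on setT psi & exists r, [/\ 0 < r,
    forall y, `|y - x| <= r -> U y /\ forall v,
      quad (h x) v <= 2 * quad (h y) v /\ quad (h y) v <= 2 * quad (h x) v
    & forall y, r < `|y - x| -> psi y = 0]].

Lemma exists_window U h x : open U ->
  (forall i j y, U y -> {for y, continuous (fun z => h z i j)}) ->
  (forall y, U y -> posdef (h y)) -> U x ->
  exists2 eta, window U h x eta & eta x = pi / 2.
Proof.
move=> oU ch ph Ux; have [d d0 Hd] := posdef_near (ph x Ux).
have nU : \forall y \near x, U y by exact: open_nbhs_nbhs.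
have nh : \forall y \near x, forall i j, `|h y i j - h x i j| <= d.
  apply: (@filter_forall _ _ _ _ (nbhs_filter x)) => i.
  apply: (@filter_forall _ _ _ _ (nbhs_filter x)) => j.
  have /cvgrPdist_le/(_ d d0) := ch i j x Ux.
  by apply: filterS => y; rewrite distrC.
have /nbhs_ballP[e /= e0 He] : nbhs x (fun y => U y /\
    forall i j, `|h y i j - h x i j| <= d) by exact: filterI.
have e2 : 0 < e / 2 by rewrite divr_gt0.
have [eta [seta eta1 eta0]] := exists_bump x e2.
exists eta => //; split => //; exists (e / 2); split => // y ye.
have /He[Uy hy] : ball x e y.
  by rewrite -ball_normE /= distrC (le_lt_trans ye)// ltr_pdivrMr// ltr_pMr// ltr1n.
split=> // v; exact: Hd.
Qed.

(** The new windows are [P cos(eta_1) .. cos(eta_(b-1)) sin(eta_b)]: since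
    [sin^2 = 1 - cos^2], the sum of their squares telescopes. *)
Lemma windows_telescope U h (bs : seq ('rV[R]_n * ('rV[R]_n -> R))) P :
  smooth_on setT P -> (forall b, b \in bs -> window U h b.1 b.2) ->
  exists2 ws : seq ('rV[R]_n * ('rV[R]_n -> R)),
    (forall b, b \in ws -> window U h b.1 b.2) &
    forall y, \sum_(b <- ws) b.2 y ^+ 2 =
              P y ^+ 2 * (1 - \prod_(b <- bs) cos (b.2 y) ^+ 2).
Proof.
elim: bs P => [|[x eta] bs IH] P sP wbs.
  by exists [::] => // y; rewrite !big_nil subrr mulr0.
have [/= Ux seta [r [r0 hr etar]]] := wbs (x, eta) (mem_head _ _).
have oT : open [set: 'rV[R]_n] by exact: openT.
have sPc : smooth_on setT (fun y => P y * cos (eta y)).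
  by apply: smooth_onM => //; apply: (smooth_on_comp1 oT (@smooth1_cos R)).
have wbs' b : b \in bs -> window U h b.1 b.2.
  by move=> bin; apply: wbs; rewrite inE bin orbT.
have [ws wws Hws] := IH _ sPc wbs'.
exists ((x, fun y => P y * sin (eta y)) :: ws) => [b|y].
  rewrite inE => /predU1P[->|/wws//] /=; split => //.
    by apply: smooth_onM => //; apply: (smooth_on_comp1 oT (@smooth1_sin R)).
  by exists r; split=> // y /etar ->; rewrite sin0 mulr0.
by rewrite !big_cons /= Hws !exprMn sin2cos2; ring.
Qed.

(** At each point of [K] at least one of the finitely many factors [cos^2] is at
    most 1/4, and all the others are at most 1. The lower bound does not depend
    on the number [N] of windows, whereas the squares of a partition of unity are
    only known to add up to at least [1 / N]. *)
Lemma windows_cover U h K : open U ->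
  (forall i j y, U y -> {for y, continuous (fun z => h z i j)}) ->
  (forall y, U y -> posdef (h y)) -> compact K -> K `<=` U ->
  exists ws : seq ('rV[R]_n * ('rV[R]_n -> R)),
    [/\ forall b, b \in ws -> window U h b.1 b.2,
        forall y, \sum_(b <- ws) b.2 y ^+ 2 <= 1 &
        forall y, K y -> 3 / 4 <= \sum_(b <- ws) b.2 y ^+ 2].
Proof.
move=> oU ch ph; rewrite compact_cover => cK KU.
have /choice[eta Heta] : forall x, exists eta,
    U x -> window U h x eta /\ eta x = pi / 2.
  move=> x; have [Ux|nUx] := pselect (U x); last by exists (fun=> 0).
  by have [eta] := exists_window oU ch ph Ux; exists eta.
pose W x : set 'rV[R]_n := [set y | `|cos (eta x y)| < 1 / 2].
have ocos x : U x -> continuous (fun y => cos (eta x y)).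
  move=> /Heta[[_ seta _] _] y; apply: continuous_comp.
    exact: smooth_on_continuous seta _.
  exact: continuous_cos.
have oW x : U x -> open (W x).
  move=> Ux.
  have -> : W x = (fun y => cos (eta x y)) @^-1` (ball (0 : R) (1 / 2)).
    by apply/seteqP; split=> y; rewrite /W /= -ball_normE /= sub0r normrN.
  by apply: open_comp; [move=> y _; exact: ocos|exact: ball_open].
have KW : K `<=` \bigcup_(x in U) W x.
  move=> y /KU Uy; exists y => //; rewrite /W /=.
  by have [_ ->] := Heta y Uy; rewrite cos_pihalf normr0 divr_gt0.
have [D DU KD] := cK _ U W oW KW.
pose bs := [seq (x, eta x) | x <- enum_fset D].
have wbs b : b \in bs -> window U h b.1 b.2.
  by move=> /mapP[x xD ->] /=; have := DU x xD; rewrite inE => /Heta[].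
have [ws wws Hws] := windows_telescope (smooth_on_cst 1 openT) wbs.
have p0 (s : seq ('rV[R]_n * ('rV[R]_n -> R))) y :
    0 <= \prod_(b <- s) cos (b.2 y) ^+ 2 <= 1.
  elim: s => [|b s IH]; rewrite ?big_nil ?ler01 ?lexx// big_cons.
  have /andP[c0 c1] : 0 <= cos (b.2 y) ^+ 2 <= 1.
    by rewrite sqr_ge0 cos2sin2 lerBlDr lerDl sqr_ge0.
  move: IH => /andP[i0 i1]; rewrite mulr_ge0//=.
  by rewrite (le_trans _ i1)// ler_piMl.
exists ws; split=> // y; rewrite Hws expr1n mul1r.
  by rewrite lerBlDr lerDl; have /andP[] := p0 bs y.
move=> Ky; have [x xD Wxy] := KD y Ky.
rewrite (big_rem (x, eta x)) /=; last by apply/mapP; exists x.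
have /andP[q0 q1] := p0 (rem (x, eta x) bs) y.
have c14 : cos (eta x y) ^+ 2 <= 1 / 4.
  rewrite -[leLHS]ger0_norm ?sqr_ge0// normrX.
  rewrite (_ : 1 / 4 = (1 / 2) ^+ 2); last by field.
  by rewrite lerXn2r ?nnegrE ?divr_ge0// ltW.
have : cos (eta x y) ^+ 2 * \prod_(b <- rem (x, eta x) bs) cos (b.2 y) ^+ 2 <= 1 / 4.
  by rewrite (le_trans _ c14)// ler_piMr// sqr_ge0.
by set p := _ * _; lra.
Qed.

End Bumps.

(** * Corrugations *)

Section Corrugation.
Variables (R : realType) (n : nat).
Implicit Types (F psi : 'rV[R]_n -> R) (x y v : 'rV[R]_n) (c : 'cV[R]_n).

Definition grad F y : 'cV[R]_n := \col_i partial i F y.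

(** The contribution to the Fisher metric of the densities [1 + F] on points of
    mass [w]. *)
Definition fisher_sum (w : R) (l : seq ('rV[R]_n -> R)) y : 'M[R]_n :=
  \sum_(F <- l) (w / (1 + F y)) *: (grad F y *m (grad F y)^T).

Lemma quad_fisher_sum w l y v : quad (fisher_sum w l y) v =
  \sum_(F <- l) w / (1 + F y) * (v *m grad F y) 0 0 ^+ 2.
Proof.
by rewrite /fisher_sum quad_sum; apply: eq_bigr => F _; rewrite quadZ quad_rank1.
Qed.

Lemma fisher_sum_bounds w l y v : 0 < w -> {in l, forall F, `|F y| <= 1 / 2} ->
  2 / 3 * w * (\sum_(F <- l) (v *m grad F y) 0 0 ^+ 2)
    <= quad (fisher_sum w l y) v <=
  2 * w * (\sum_(F <- l) (v *m grad F y) 0 0 ^+ 2).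
Proof.
move=> w0 Hl; rewrite quad_fisher_sum !mulr_sumr.
have H F : F \in l -> 2 / 3 * w <= w / (1 + F y) <= 2 * w.
  move=> /Hl; rewrite ler_norml => /andP[F1 F2].
  have F0 : 0 < 1 + F y by lra.
  have p1 : 0 <= w * (1 / 2 - F y) by rewrite mulr_ge0 ?subr_ge0// ltW.
  have p2 : 0 <= w * (1 / 2 + F y) by apply: mulr_ge0; [exact: ltW|lra].
  by rewrite ler_pdivlMr// ler_pdivrMr//; apply/andP; split; nra.
by apply/andP; split; rewrite big_seq [leRHS]big_seq; apply: ler_sum => F;
   move=> /H /andP[H1 H2]; rewrite ler_wpM2r// sqr_ge0.
Qed.

Lemma grad_outside F x y (r : R) :
  (forall y, r < `|y - x| -> F y = 0) -> r < `|y - x| -> grad F y = 0.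
Proof.
move=> F0 ry; apply/colP => i; rewrite !mxE (@near_eq_partial _ _ F (fun=> 0)).
  by rewrite /partial derive_cst.
have : nbhs y (~` closed_ball_ Num.Def.normr x r).
  apply: open_nbhs_nbhs; split; first by rewrite openC; exact: closed_closed_ball_.
  by rewrite /closed_ball_ /= distrC; apply/negP; rewrite -ltNge.
apply: filterS => z; rewrite /closed_ball_ /= distrC => /negP; rewrite -ltNge.
exact: F0.
Qed.

Lemma grad_bounded F x (r : R) : smooth_on setT F ->
  (forall y, r < `|y - x| -> F y = 0) ->
  exists2 D, 0 <= D & forall y i, `|grad F y i 0| <= D.
Proof.
move=> sF F0.
have H i : exists2 D, 0 <= D & forall y, `|grad F y i 0| <= D.
  have cp : continuous (partial i F).
    by move=> y; apply: (smooth_on_continuous (smooth_on_partial i sF)).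
  have cK := continuous_compact (continuous_subspaceT cp) (@closed_ball_compact R n x r).
  have [M [_ HM]] := compact_bounded cK.
  exists (`|M| + 1) => [|y]; first by rewrite addr_ge0.
  have [ry|ry] := ltP r `|y - x|.
    by rewrite (grad_outside F0 ry) mxE normr0 addr_ge0.
  rewrite mxE; apply: HM; last by exists y.
  by rewrite (le_lt_trans (ler_norm _))// ltrDl.
have /choice[D HD] : forall i, exists D, 0 <= D /\ forall y, `|grad F y i 0| <= D.
  by move=> i; have [D D0 HD] := H i; exists D.
exists (\sum_i D i) => [|y i]; first by apply: sumr_ge0 => i _; have [] := HD i.
rewrite (bigD1 i)//= ler_wpDr ?sumr_ge0// => [j _|]; first by have [] := HD j.
by have [_] := HD i.
Qed.

Lemma grad_controlled F x (r : R) A : smooth_on setT F ->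
  (forall y, r < `|y - x| -> F y = 0) -> posdef A ->
  exists2 B, 0 <= B & forall y v, (v *m grad F y) 0 0 ^+ 2 <= B * quad A v.
Proof.
move=> sF F0 Apd; have [D D0 HD] := grad_bounded sF F0.
have [C C0 HC] := posdef_coercive Apd.
exists ((n%:R * D) ^+ 2 * C) => [|y v].
  by rewrite mulr_ge0 ?sqr_ge0// ltW.
have Cq0 : 0 <= C * quad A v by rewrite mulr_ge0 ?posdef_ge0// ltW.
have Hv i : `|v 0 i| <= Num.sqrt (C * quad A v).
  by rewrite -sqrtr_sqr ler_sqrt.
rewrite -[leLHS]ger0_norm ?sqr_ge0// normrX mxE.
have : `|\sum_j v 0 j * grad F y j 0| <= n%:R * D * Num.sqrt (C * quad A v).
  apply: le_trans (ler_norm_sum _ _ _) _.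
  apply: (@le_trans _ _ (\sum_(j < n) D * Num.sqrt (C * quad A v))).
    by apply: ler_sum => j _; rewrite normrM mulrC ler_pM.
  by rewrite sumr_const card_ord -[leLHS]mulr_natl mulrA.
move=> /(@lerXn2r _ 2%N); rewrite !nnegrE normr_ge0 => /(_ isT).
rewrite !mulr_ge0 ?sqrtr_ge0// => /(_ isT) /le_trans; apply.
by rewrite exprMn sqr_sqrtr// mulrA.
Qed.

Lemma partial_linear_form c i y : partial i (fun y => (y *m c) 0 0) y = c i 0.
Proof.
rewrite /partial /derive; apply: lim_near_cst => //.
near=> h; rewrite /= mulmxDl mxE addrK -scalemxAl mxE.
rewrite /GRing.scale /= mulrA mulVf; last by near: h; exact: nbhs_dnbhs_neq.
by rewrite mul1r -rowE mxE.
Unshelve. all: by end_near. Qed.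

Lemma smooth_linear_form c : smooth_on setT (fun y => (y *m c) 0 0).
Proof.
have oT : open [set: 'rV[R]_n] by exact: openT.
rewrite (_ : (fun _ => _) = fun y => \sum_j y 0 j * c j 0); last first.
  by apply/funext => y; rewrite mxE.
apply: smooth_expr_smooth => //; apply: smooth_expr_sum => // j.
apply: SmoothMul; last exact: smooth_expr_cst.
by apply: SmoothBase; exact: smooth_on_coord.
Qed.

(** An oscillation of profile [S] in the direction of the linear form [c]. *)
Definition wave psi (a lam : R) (S : R -> R) c y : R :=
  a * (psi y * S (lam * (y *m c) 0 0)).

Lemma smooth_wave psi a lam S c : smooth_on setT psi -> smooth1 S ->
  smooth_on setT (wave psi a lam S c).
Proof.
move=> spsi sS; have oT : open [set: 'rV[R]_n] by exact: openT.
have scst d : smooth_on [set: 'rV[R]_n] (fun=> d) by exact: smooth_on_cst.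
apply: smooth_onM => //; apply: smooth_onM => //; apply: smooth_on_comp1 => //.
by apply: smooth_onM => //; exact: smooth_linear_form.
Qed.

Lemma grad_wave psi a lam (S S' : R -> R) c y : smooth_on setT psi ->
  (forall t : R, is_derive t 1 S (S' t)) ->
  grad (wave psi a lam S c) y =
  a *: ((psi y * S' (lam * (y *m c) 0 0) * lam) *: c +
        S (lam * (y *m c) 0 0) *: grad psi y).
Proof.
move=> spsi dS; have oT : open [set: 'rV[R]_n] by exact: openT.
have dpsi := smooth_on_differentiable spsi (I : setT y).
have dL := smooth_on_differentiable (smooth_linear_form c) (I : setT y).
have dc d : differentiable (fun _ : 'rV[R]_n => d : R) y by exact: differentiable_cst.
have dlL : differentiable (fun y : 'rV[R]_n => lam * (y *m c) 0 0) y.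
  exact: (@differentiableM _ _ (fun=> lam)).
have dSL : differentiable (fun y : 'rV[R]_n => S (lam * (y *m c) 0 0)) y.
  exact: differentiable_comp1 (dS _) dlL.
have pc d i : partial i (fun _ : 'rV[R]_n => d : R) y = 0 by rewrite /partial derive_cst.
set th := lam * (y *m c) 0 0.
apply/colP => i; rewrite !mxE /wave (@partialM _ _ (fun=> a))//; last exact: differentiableM.
rewrite pc mulr0 addr0 partialM// (partial_comp1 _ (dS _))// (@partialM _ _ (fun=> lam))//.
rewrite pc partial_linear_form -/th; ring.
Qed.

(** Around a window [psi], the constant form [A] is approximated by the sum of
    the squares of the differentials of [psi] times fast oscillating functions:
    [A] is a sum of squares of linear forms, along each of which the functions
    oscillate with frequency [lam]; the derivatives of [psi] only contribute a
    term of order [lam^-2]. *)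
Lemma corrugation x (r : R) psi A (w eps : R) :
  smooth_on setT psi -> (forall y, r < `|y - x| -> psi y = 0) ->
  (forall y, psi y ^+ 2 <= 1) -> posdef A -> 0 < w -> 0 < eps ->
  exists l : seq ('rV[R]_n -> R), [/\ size l = (n * 4)%N,
    forall F, F \in l -> [/\ smooth_on setT F, (forall y, `|F y| <= 1 / 2) &
      forall y, r < `|y - x| -> F y = 0],
    forall y, \sum_(F <- l) F y = 0,
    forall y v, 1 / 24 * psi y ^+ 2 * quad A v <= quad (fisher_sum w l y) v
      <= (1 / 8 * psi y ^+ 2 + eps) * quad A v &
    forall y, r < `|y - x| -> fisher_sum w l y = 0].
Proof.
move=> spsi psi0 psi1 Apd w0 eps0.
have [B B0 HB] := grad_controlled spsi psi0 Apd.
have [cols scols Acols] := sum_of_squares Apd.1 (fun v => posdef_ge0 v Apd).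
(* The amplitude [a = k / lam] is tuned so that [w a^2 lam^2 = 1/32]. *)
pose k := Num.sqrt (1 / (32 * w)).
have k0 : 0 <= k by rewrite sqrtr_ge0.
have k2 : k ^+ 2 = 1 / (32 * w) by rewrite sqr_sqrtr// divr_ge0// mulr_ge0// ltW.
have m0 : 0 <= n%:R * B / (8 * eps) by rewrite divr_ge0 ?mulr_ge0// ltW.
(* The second summand makes the waves smaller than 1/2, the third one makes the
   derivatives of [psi] contribute less than [eps]. *)
pose lam := 1 + 2 * k + n%:R * B / (8 * eps).
have lam1 : 1 <= lam by rewrite /lam; lra.
have lam0 : 0 < lam by lra.
have lamn0 : lam != 0 by rewrite gt_eqF.
pose a := k / lam.
have wa : w * a ^+ 2 * lam ^+ 2 = 1 / 32.
  by rewrite /a expr_div_n k2; field; rewrite lamn0 gt_eqF.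
have a0 : 0 <= a by rewrite divr_ge0// ltW.
have a12 : a <= 1 / 2 by rewrite ler_pdivrMr//; move: m0; rewrite /lam; lra.
have lameps : n%:R * B / (8 * lam ^+ 2) <= eps.
  have e8 : 0 < 8 * eps by rewrite mulr_gt0.
  have : n%:R * B / (8 * eps) <= lam ^+ 2.
    apply: (@le_trans _ _ lam); first by rewrite /lam; lra.
    by rewrite expr2 ler_peMl// ltW.
  rewrite ler_pdivrMr// ler_pdivrMr ?mulr_gt0 ?exprn_gt0//.
  by rewrite [lam ^+ 2 * _]mulrC [eps * _]mulrCA mulrA.
have psin y : `|psi y| <= 1.
  by rewrite -(@ler_pXn2r _ 2%N) ?nnegrE// expr1n -normrX ger0_norm ?sqr_ge0.
(* Opposite waves cancel in the sum, and quarter-period shifts give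
   [cos^2 + sin^2 = 1] in the squares. *)
pose ps : seq (R * (R -> R)) := [:: (a, cos); (a, sin); (- a, cos); (- a, sin)].
pose l := [seq wave psi p.1 lam p.2 c | c <- cols, p <- ps].
have lP F : F \in l -> [/\ smooth_on setT F, (forall y, `|F y| <= 1 / 2) &
      forall y, r < `|y - x| -> F y = 0].
  move=> /allpairsP[[c p] /= [_ pps ->]].
  have [pa Ps PS] : [/\ `|p.1| = a, smooth1 p.2 & forall t, `|p.2 t| <= 1].
    have cb t : `|cos t : R| <= 1 by rewrite ler_norml cos_geN1 cos_le1.
    have sb t : `|sin t : R| <= 1 by rewrite ler_norml sin_geN1 sin_le1.
    move: pps; rewrite !inE => /or4P[] /eqP -> /=; rewrite ?normrN ger0_norm//;
      split=> //; by [exact: smooth1_cos|exact: smooth1_sin].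
  split=> [|y|y /psi0 psiy]; first exact: smooth_wave.
    rewrite /wave !normrM pa (le_trans _ a12)// ler_piMr//.
    by rewrite mulr_ile1.
  by rewrite /wave psiy mul0r mulr0.
have raw y v : \sum_(F <- l) (v *m grad F y) 0 0 ^+ 2 =
  2 * a ^+ 2 * (lam ^+ 2 * psi y ^+ 2 * quad A v +
                n%:R * (v *m grad psi y) 0 0 ^+ 2).
  rewrite /l big_allpairs_dep /=.
  have -> : quad A v = \sum_(c <- cols) (v *m c) 0 0 ^+ 2.
    by rewrite Acols quad_sum; apply: eq_bigr => c _; rewrite quad_rank1.
  have -> : n%:R * (v *m grad psi y) 0 0 ^+ 2 =
            \sum_(c <- cols) (v *m grad psi y) 0 0 ^+ 2.
    by rewrite big_const_seq count_predT scols iter_addr_0 mulr_natl.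
  rewrite mulr_sumr -big_split /= mulr_sumr; apply: eq_bigr => c _.
  rewrite !big_cons big_nil /=.
  have dc (t : R) : is_derive t 1 (@cos R) (- sin t) by exact: is_derive_cos.
  have ds (t : R) : is_derive t 1 (@sin R) (cos t) by exact: is_derive_sin.
  rewrite !(grad_wave _ _ _ _ spsi dc) !(grad_wave _ _ _ _ spsi ds).
  set th := lam * _.
  have lin (b p q : R) (u u' : 'cV[R]_n) :
      (v *m (b *: (p *: u + q *: u'))) 0 0 =
      b * (p * (v *m u) 0 0 + q * (v *m u') 0 0).
    by rewrite -scalemxAr mulmxDr -!scalemxAr !mxE.
  rewrite !lin; have := cos2Dsin2 th.
  set C := cos th; set S := sin th => CS.
  set X := (v *m c) 0 0; set Y := (v *m _) 0 0.
  transitivity (2 * a ^+ 2 *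
    ((C ^+ 2 + S ^+ 2) * (lam ^+ 2 * psi y ^+ 2 * X ^+ 2 + Y ^+ 2))).
    ring.
  by rewrite CS mul1r.
have l12 y : {in l, forall F, `|F y| <= 1 / 2} by move=> F /lP[].
have w1 : w * a ^+ 2 = 1 / (32 * lam ^+ 2).
  by rewrite -[LHS](mulfK (expf_neq0 2 lamn0)) wa; field.
have wa0 : 0 <= w * a ^+ 2 by rewrite mulr_ge0 ?sqr_ge0// ltW.
exists l; split=> //.
- by rewrite size_allpairs scols.
- move=> y; rewrite /l big_allpairs_dep big1// => c _; rewrite !big_cons big_nil /wave /=.
  ring.
- move=> y v; have /andP[Hl Hu] := fisher_sum_bounds v w0 (l12 y).
  apply/andP; split.
  apply: le_trans Hl; rewrite raw.
  have -> : 2 / 3 * w * (2 * a ^+ 2 * (lam ^+ 2 * psi y ^+ 2 * quad A v +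
       n%:R * (v *m grad psi y) 0 0 ^+ 2)) =
    4 / 3 * (w * a ^+ 2 * lam ^+ 2) * (psi y ^+ 2 * quad A v) +
    4 / 3 * (w * a ^+ 2) * (n%:R * (v *m grad psi y) 0 0 ^+ 2) by ring.
  rewrite wa.
  have : 0 <= 4 / 3 * (w * a ^+ 2) * (n%:R * (v *m grad psi y) 0 0 ^+ 2).
    by apply: mulr_ge0; [apply: mulr_ge0 => //; lra|rewrite mulr_ge0 ?sqr_ge0].
  by set z := 4 / 3 * (w * _) * _; move=> z0; rewrite -mulrA; lra.
  apply: le_trans Hu _; rewrite raw.
  have -> : 2 * w * (2 * a ^+ 2 * (lam ^+ 2 * psi y ^+ 2 * quad A v +
       n%:R * (v *m grad psi y) 0 0 ^+ 2)) =
    4 * (w * a ^+ 2 * lam ^+ 2) * (psi y ^+ 2 * quad A v) +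
    4 * (w * a ^+ 2) * (n%:R * (v *m grad psi y) 0 0 ^+ 2) by ring.
  rewrite wa w1 [leRHS]mulrDl lerD//; first by rewrite -mulrA; lra.
  apply: (@le_trans _ _ (n%:R * B / (8 * lam ^+ 2) * quad A v)); last first.
    by rewrite ler_wpM2r// posdef_ge0.
  rewrite [leRHS](_ : _ =
    4 * (1 / (32 * lam ^+ 2)) * (n%:R * (B * quad A v))); last by field.
  by rewrite !ler_wpM2l// mulr_ge0// divr_ge0// mulr_ge0// sqr_ge0.
- move=> y ry; rewrite /fisher_sum big_seq big1// => F /lP[_ _ F0].
  by rewrite (grad_outside F0 ry) mul0mx scaler0.
Qed.

End Corrugation.

(** * Exhausting a constant proportion of a metric on a compact set *)

Section LocalRound.
Variables (R : realType) (n : nat).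
Implicit Types (U K : set 'rV[R]_n) (h : 'rV[R]_n -> 'M[R]_n) (y v : 'rV[R]_n).

Lemma fisher_sum_cat w (l1 l2 : seq ('rV[R]_n -> R)) y :
  fisher_sum w (l1 ++ l2) y = fisher_sum w l1 y + fisher_sum w l2 y.
Proof. by rewrite /fisher_sum big_cat. Qed.

Lemma grad_cst (c : R) y : grad (fun _ : 'rV[R]_n => c) y = 0.
Proof. by apply/colP => i; rewrite !mxE /partial derive_cst. Qed.

(** Samples seen in a chart. The sum has to vanish for the mass of the densities
    [1 + F] to be the same at all points. *)
Definition test_functions K (l : seq ('rV[R]_n -> R)) : Prop :=
  (forall F, F \in l -> [/\ smooth_on setT F, (forall y, `|F y| <= 1 / 2) &
    forall y, ~ K y -> F y = 0]) /\
  forall y, \sum_(F <- l) F y = 0.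

Lemma test_functions_cat K1 K2 l1 l2 :
  test_functions K1 l1 -> test_functions K2 l2 ->
  test_functions (K1 `|` K2) (l1 ++ l2).
Proof.
move=> [H1 S1] [H2 S2]; split=> [F|y]; last by rewrite big_cat /= S1 S2 addr0.
rewrite mem_cat => /orP[/H1|/H2][sF F1 F0]; split=> // y /not_orP[Ky1 Ky2];
  exact: F0.
Qed.

Lemma window_corrugation U h x psi (w eps : R) :
  window U h x psi -> (forall y, U y -> posdef (h y)) ->
  (forall y, psi y ^+ 2 <= 1) -> 0 < w -> 0 < eps ->
  exists l K, [/\ size l = (n * 4)%N, compact K /\ K `<=` U, test_functions K l,
    forall y v, U y -> 1 / 48 * psi y ^+ 2 * quad (h y) v
      <= quad (fisher_sum w l y) v &
    forall y v, U y -> quad (fisher_sum w l y) v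
      <= (1 / 4 * psi y ^+ 2 + 2 * eps) * quad (h y) v].
Proof.
move=> [Ux spsi [r [r0 hr psi0]]] ph psi1 w0 eps0.
have [l [sl lP lS lB l0]] := corrugation spsi psi0 psi1 (ph x Ux) w0 eps0.
exists l, [set y | `|y - x| <= r]; split => //.
- by split; [exact: closed_ball_compact|move=> y /hr[]].
- split=> // F /lP[sF F1 F0]; split=> // y /negP; rewrite -ltNge; exact: F0.
- move=> y v Uy; have q0 := posdef_ge0 v (ph y Uy).
  have [yr|yr] := leP `|y - x| r; last first.
    by rewrite psi0// expr0n mulr0 mul0r l0// quad0.
  have /andP[+ _] := lB y v; apply: le_trans.
  have [_ /(_ v)[_ hv]] := hr y yr.
  have := ler_wpM2l (sqr_ge0 (psi y)) hv; lra.
- move=> y v Uy; have q0 := posdef_ge0 v (ph y Uy).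
  have p0 : 0 <= psi y ^+ 2 by exact: sqr_ge0.
  have [yr|yr] := leP `|y - x| r; last first.
    by rewrite l0// quad0 mulr_ge0//; lra.
  have /andP[_ /le_trans] := lB y v; apply.
  have [_ /(_ v)[hv _]] := hr y yr.
  have e0 : 0 <= 1 / 8 * psi y ^+ 2 + eps by lra.
  have := ler_wpM2l e0 hv; lra.
Qed.

Lemma windows_corrugation U h (ws : seq ('rV[R]_n * ('rV[R]_n -> R))) (w eps : R) :
  (forall b, b \in ws -> window U h b.1 b.2 /\ forall y, b.2 y ^+ 2 <= 1) ->
  (forall y, U y -> posdef (h y)) -> 0 < w -> 0 < eps ->
  exists l K, [/\ size l = (size ws * (n * 4))%N, compact K /\ K `<=` U,
    test_functions K l,
    forall y v, U y -> 1 / 48 * (\sum_(b <- ws) b.2 y ^+ 2) * quad (h y) v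
      <= quad (fisher_sum w l y) v &
    forall y v, U y -> quad (fisher_sum w l y) v
      <= (1 / 4 * (\sum_(b <- ws) b.2 y ^+ 2) + 2 * eps * (size ws)%:R)
         * quad (h y) v].
Proof.
move=> + ph w0 eps0; elim: ws => [_|b ws IH wsP].
  exists [::], set0; split => //.
  - by split; [exact: compact0|].
  - by split=> // y; rewrite big_nil.
  - by move=> y v _; rewrite /fisher_sum !big_nil quad0 mulr0 mul0r.
  - by move=> y v _; rewrite /fisher_sum !big_nil quad0 !mulr0 addr0 mul0r.
have [|l [K [sl [cK KU] lP lb ub]]] := IH.
  by move=> c cws; apply: wsP; rewrite inE cws orbT.
have [bw b1] := wsP b (mem_head _ _).
have [l' [K' [sl' [cK' KU'] lP' lb' ub']]] := window_corrugation bw ph b1 w0 eps0.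
exists (l' ++ l), (K' `|` K); split.
- by rewrite size_cat sl sl' mulSn.
- by split; [exact: compactU|rewrite subUset].
- exact: test_functions_cat.
- move=> y v Uy; rewrite fisher_sum_cat quadD big_cons.
  by have := lerD (lb' y v Uy) (lb y v Uy); apply: le_trans; lra.
- move=> y v Uy; rewrite fisher_sum_cat quadD big_cons /= -[(size ws).+1%:R]natr1.
  by have := lerD (ub' y v Uy) (ub y v Uy); move=> /le_trans; apply; lra.
Qed.

(** With [eps] inversely proportional to the number of windows, the errors add up
    to at most [h / 4] and the main terms lie between [h / 64] and [h / 4]. *)
Lemma local_round U h K (omega : R) : open U ->
  (forall i j y, U y -> {for y, continuous (fun z => h z i j)}) ->
  (forall y, U y -> posdef (h y)) -> compact K -> K `<=` U -> 0 < omega ->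
  exists l w K', [/\ 0 < w /\ w * (size l)%:R = omega,
    compact K' /\ K' `<=` U, test_functions K' l,
    forall y v, U y -> quad (fisher_sum w l y) v <= 1 / 2 * quad (h y) v &
    forall y v, K y -> 1 / 64 * quad (h y) v <= quad (fisher_sum w l y) v].
Proof.
move=> oU ch ph cK KU omega0.
have [ws [wsw ws1 wsK]] := windows_cover oU ch ph cK KU.
pose w := omega / (1 + size ws * (n * 4))%N%:R.
pose eps : R := (8 * (size ws).+1%:R)^-1.
have w0 : 0 < w by rewrite divr_gt0.
have eps0 : 0 < eps by rewrite invr_gt0 mulr_gt0.
have wsP b : b \in ws -> window U h b.1 b.2 /\ forall y, b.2 y ^+ 2 <= 1.
  move=> bws; split=> [|y]; first exact: wsw.
  apply: le_trans (ws1 y); rewrite (big_rem b)//= lerDl sumr_ge0// => c _.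
  exact: sqr_ge0.
have [l [K' [sl [cK' KU'] [lP lS] lb ub]]] := windows_corrugation wsP ph w0 eps0.
have f0 y v : quad (fisher_sum w ((fun=> 0) :: l) y) v = quad (fisher_sum w l y) v.
  by rewrite /fisher_sum big_cons grad_cst mul0mx scaler0 add0r.
(* The zero function only carries mass: without it, no function at all would be
   left to carry the mass [omega] if [K] is empty or [n = 0]. *)
exists ((fun=> 0) :: l), w, K'; split=> //.
- by rewrite /= sl; split=> //; rewrite /w divfK// pnatr_eq0.
- split=> [F|y]; last by rewrite big_cons lS addr0.
  rewrite inE => /predU1P[->|/lP//]; split=> [|y|//]; last by rewrite normr0.
  by apply: smooth_on_cst; exact: openT.
- move=> y v Uy; rewrite f0; apply: le_trans (ub y v Uy) _.
  rewrite ler_wpM2r ?posdef_ge0//; first exact: ph.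
  have : 2 * eps * (size ws)%:R <= 1 / 4.
    rewrite /eps mulrAC ler_pdivrMr ?mulr_gt0// -natr1.
    by have : 0 <= (size ws)%:R :> R by []; lra.
  by have := ws1 y; lra.
- move=> y v Ky; have Uy := KU y Ky; rewrite f0.
  apply: le_trans (lb y v Uy).
  by rewrite ler_wpM2r ?posdef_ge0//; [exact: ph|have := wsK y Ky; lra].
Qed.

End LocalRound.

(** * Transport to a manifold *)

Section Charts.
Variables (R : realType) (n : nat) (M : smoothManifold R n).
Implicit Types (c : chart R n M) (p : M) (s : M -> R) (x : 'rV[R]_n).

Lemma chart_invP c x : chart_cod c x ->
  chart_dom c (chart_inv c x) /\ chart_map c (chart_inv c x) = x.
Proof. by move=> [p cp <-]; rewrite chart_mapK. Qed.

Lemma chart_image_open c (W : set M) : open W ->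
  open (chart_map c @` (chart_dom c `&` W)).
Proof.
move=> oW; rewrite openE => _ [p [cp Wp] <-]; rewrite /interior.
have xc : chart_cod c (chart_map c p) by exists p.
have n1 : nbhs (chart_map c p) (chart_cod c).
  by apply: open_nbhs_nbhs; split => //; exact: chart_cod_open.
have n2 : nbhs (chart_map c p) (chart_inv c @^-1` W).
  apply: (chart_inv_continuous xc); rewrite chart_mapK//.
  exact: open_nbhs_nbhs.
apply: filterS (filterI n1 n2) => z [/chart_invP[cz zE] Wz].
by exists (chart_inv c z).
Qed.

Lemma near_chart_image c (W : set M) p : open W -> chart_dom c p -> W p ->
  \forall z \near chart_map c p, chart_cod c z /\ W (chart_inv c z).
Proof.
move=> oW cp Wp; have : open_nbhs (chart_map c p) (chart_map c @` (chart_dom c `&` W)).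
  by split; [exact: chart_image_open|exists p].
move=> /open_nbhs_nbhs; apply: filterS => _ [q [cq Wq] <-].
by split; [exists q|rewrite chart_mapK].
Qed.

Definition chart_grad s c p : 'cV[R]_n := grad (s \o chart_inv c) (chart_map c p).

Lemma chart_grad_eq0 s c p (W : set M) : open W -> W p ->
  (forall q, W q -> s q = 0) -> chart_dom c p -> chart_grad s c p = 0.
Proof.
move=> oW Wp sW cp; apply/colP => i; rewrite !mxE.
rewrite (@near_eq_partial _ _ _ (fun=> 0)); first by rewrite /partial derive_cst.
by apply: filterS (near_chart_image oW cp Wp) => z [_ /sW].
Qed.

Lemma differentiable_transition c c' p : atlas c -> atlas c' ->
  chart_dom c p -> chart_dom c' p ->
  forall j, differentiable (fun x => chart_map c' (chart_inv c x) 0 j) (chart_map c p).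
Proof.
move=> ac ac' cp cp' j; apply: (smooth_on_differentiable (atlas_compatible ac ac' j)).
by exists p.
Qed.

Lemma transition_jacobianE c c' p i j : atlas c -> atlas c' ->
  chart_dom c p -> chart_dom c' p ->
  transition_jacobian c c' p i j =
  partial i (fun x => chart_map c' (chart_inv c x) 0 j) (chart_map c p).
Proof.
move=> ac ac' cp cp'; have dt := differentiable_transition ac ac' cp cp'.
rewrite partialE// /transition_jacobian /jacobian mxE diff_row_coord//.
exact: differentiable_row.
Qed.

Lemma chart_grad_transition s c c' p : smooth_function s -> atlas c -> atlas c' ->
  chart_dom c p -> chart_dom c' p ->
  chart_grad s c p = transition_jacobian c c' p *m chart_grad s c' p.
Proof.
move=> ss ac ac' cp cp'.
have dt := differentiable_transition ac ac' cp cp'.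
pose phi x := chart_map c' (chart_inv c x).
have phip : phi (chart_map c p) = chart_map c' p by rewrite /phi chart_mapK.
apply/colP => i; rewrite !mxE.
rewrite (@near_eq_partial _ _ _ (fun x => (s \o chart_inv c') (phi x))); last first.
  apply: filterS (near_chart_image (chart_dom_open c') cp cp') => z [_ zc'].
  by rewrite /phi /= chart_mapK.
rewrite partial_comp//; last first.
  by rewrite phip; apply: (smooth_on_differentiable (ss c' ac')); exists p.
by apply: eq_bigr => j _; rewrite phip transition_jacobianE// mxE mulrC.
Qed.

Definition extend c (F : 'rV[R]_n -> R) : M -> R := fun p =>
  if pselect (chart_dom c p) then F (chart_map c p) else 0.

Lemma extendE c F p : chart_dom c p -> extend c F p = F (chart_map c p).
Proof. by move=> cp; rewrite /extend; case: pselect. Qed.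

Lemma chart_grad_extend c F p : chart_dom c p ->
  chart_grad (extend c F) c p = grad F (chart_map c p).
Proof.
move=> cp; apply/colP => i; rewrite !mxE; apply: near_eq_partial.
apply: filterS (near_chart_image openT cp I) => z [/chart_invP[cz zE] _].
by rewrite /= extendE// zE.
Qed.

(** A function supported in a compact part of a chart can be extended by zero
    because this compact part is closed in [M], which is Hausdorff. *)
Lemma chart_inv_closed c K : compact K -> K `<=` chart_cod c ->
  closed (chart_inv c @` K).
Proof.
move=> cK Kc; apply: compact_closed; first exact: points_hausdorff.
apply: continuous_compact => //; apply: continuous_in_subspaceT => x.
by rewrite inE => /Kc; exact: chart_inv_continuous.
Qed.

Lemma extend_outside c F K p : (forall y, ~ K y -> F y = 0) ->
  ~ (chart_inv c @` K) p -> extend c F p = 0.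
Proof.
move=> F0 pK; rewrite /extend; case: pselect => // cp; apply: F0 => Kp.
by apply: pK; exists (chart_map c p) => //; rewrite chart_mapK.
Qed.

Lemma smooth_extend c F K : atlas c -> smooth_on setT F -> compact K ->
  K `<=` chart_cod c -> (forall y, ~ K y -> F y = 0) ->
  smooth_function (extend c F).
Proof.
move=> ac sF cK Kc F0 c' ac' t x xc'; have [pc' xE] := chart_invP xc'.
set p := chart_inv c' x in pc' xE.
have [cp|ncp] := pselect (chart_dom c p).
  pose V := chart_map c' @` (chart_dom c' `&` chart_dom c).
  have oV : open V by apply: chart_image_open; exact: chart_dom_open.
  have Vx : V x by exists p.
  suff : smooth_on V (extend c F \o chart_inv c') by apply.
  apply: (@eq_smooth_on _ _ _ (fun z => F (chart_map c (chart_inv c' z)))) => //.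
    by move=> _ [q [q' qc] <-]; rewrite /= extendE ?chart_mapK.
  apply: smooth_expr_smooth => //.
  apply: (@SmoothComp _ _ _ _ F (fun z => chart_map c (chart_inv c' z))) => // j.
  apply: SmoothBase; exact: (atlas_compatible ac' ac j).
have oW : open (~` (chart_inv c @` K)).
  by rewrite openC; exact: chart_inv_closed.
pose V := chart_map c' @` (chart_dom c' `&` ~` (chart_inv c @` K)).
have oV : open V by exact: chart_image_open.
have Vx : V x.
  exists p => //; split=> // -[y Ky yp]; apply: ncp; rewrite -yp.
  by have [] := chart_invP (Kc y Ky).
suff : smooth_on V (extend c F \o chart_inv c') by apply.
apply: (@eq_smooth_on _ _ _ (fun=> 0)) => //; last exact: smooth_on_cst.
move=> _ [q [q' qK] <-]; rewrite /= chart_mapK//.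
by apply/esym; exact: extend_outside F0 qK.
Qed.

End Charts.

Section GlobalRound.
Variables (R : realType) (n : nat) (M : smoothManifold R n).
Implicit Types (c : chart R n M) (p : M) (h : field M n n).

(** The sample space. The bound 1/2 keeps the densities [1 + s] between 1/2 and
    3/2. *)
Definition sample : Type :=
  {s : M -> R | smooth_function s /\ forall p, `|s p| <= 1 / 2}.

Definition fisher_field (w : R) (l : seq sample) : field M n n :=
  fun c p => fisher_sum w [seq sval s \o chart_inv c | s <- l] (chart_map c p).

(** The properties of a metric that the subtraction of a round preserves.
    Continuity lets the next round freeze the remainder near a point. *)
Definition continuous_metric h : Prop :=
  [/\ forall c, atlas c -> forall i j x, chart_cod c x ->
        {for x, continuous (fun z => local h c z i j)},
      on_overlaps (fun c c' p => h c p =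
        transition_jacobian c c' p *m h c' p *m (transition_jacobian c c' p)^T)
    & everywhere (fun c p => posdef (h c p))].

Lemma riemannian_continuous_metric h : riemannian_metric h -> continuous_metric h.
Proof.
move=> [[sh th] symh ph]; split=> // [c ac i j x xc|c p ac cp].
  by apply: smooth_on_continuous xc; exact: sh.
by split=> [|v]; [exact: symh|exact: ph].
Qed.

Lemma quad_congr (J A : 'M[R]_n) v : quad (J *m A *m J^T) v = quad A (v *m J).
Proof. by rewrite /quad /bil trmx_mul !mulmxA. Qed.

Lemma fisher_fieldE w l c p : chart_dom c p ->
  fisher_field w l c p = \sum_(s <- l) (w / (1 + sval s p)) *:
    (chart_grad (sval s) c p *m (chart_grad (sval s) c p)^T).
Proof.
move=> cp; rewrite /fisher_field /fisher_sum big_map; apply: eq_bigr => s _.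
by rewrite /= chart_mapK.
Qed.

Lemma fisher_field_transition w l c c' p : atlas c -> atlas c' ->
  chart_dom c p -> chart_dom c' p ->
  fisher_field w l c p = transition_jacobian c c' p *m fisher_field w l c' p
                         *m (transition_jacobian c c' p)^T.
Proof.
move=> ac ac' cp cp'; rewrite !fisher_fieldE// mulmx_sumr mulmx_suml.
apply: eq_bigr => s _; have [ss _] := svalP s.
rewrite (chart_grad_transition ss ac ac' cp cp') -scalemxAr -scalemxAl.
by rewrite trmx_mul !mulmxA.
Qed.

Lemma continuous_sum (I : Type) (r : seq I) (f : I -> 'rV[R]_n -> R) x :
  (forall i, {for x, continuous (f i)}) ->
  {for x, continuous (fun z => \sum_(i <- r) f i z)}.
Proof.
move=> cf; elim: r => [|i r IH].
  rewrite (_ : (fun z => _) = fun=> 0); first exact: cst_continuous.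
  by apply/funext => z; rewrite big_nil.
rewrite (_ : (fun z => _) = fun z => f i z + \sum_(j <- r) f j z).
  exact: continuousD.
by apply/funext => z; rewrite big_cons.
Qed.

Lemma fisher_field_continuous w l c i j x : atlas c -> chart_cod c x ->
  {for x, continuous (fun z => local (fisher_field w l) c z i j)}.
Proof.
move=> ac xc.
have oc : open (chart_cod c) by exact: chart_cod_open.
have nc : \forall z \near x, chart_cod c z by exact: open_nbhs_nbhs.
pose T z := \sum_(s <- l) (w * (1 + sval s (chart_inv c z))^-1) *
  (partial i (sval s \o chart_inv c) z * partial j (sval s \o chart_inv c) z).
have TE z : chart_cod c z -> T z = local (fisher_field w l) c z i j.
  move=> /chart_invP[cz zE]; rewrite /local fisher_fieldE// summxE.
  by apply: eq_bigr => s _; rewrite !mxE big_ord1 !mxE zE.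
have cT : {for x, continuous T}.
  apply: continuous_sum => s.
  have [ss sb] := svalP s; have sc := ss c ac.
  have s1 : 1 + sval s (chart_inv c x) != 0.
    have := sb (chart_inv c x); rewrite ler_norml => /andP[s0 _].
    have : 0 < 1 + sval s (chart_inv c x) by lra.
    by move=> /gt_eqF ->.
  apply: continuousM.
    apply: continuousM; first exact: cst_continuous.
    apply: continuousV => //; apply: continuousD; first exact: cst_continuous.
    exact: smooth_on_continuous sc xc.
  apply: continuousM; apply: smooth_on_continuous xc; exact: smooth_on_partial.
rewrite /prop_for /continuous_at -TE//.
apply: cvg_trans cT.
apply: (@near_eq_cvg _ _ _ (nbhs_filter x) T).
by near=> z; rewrite TE//; near: z; exact: nc.
Unshelve. all: by end_near. Qed.

Lemma fisher_field_sym w l c p : (fisher_field w l c p)^T = fisher_field w l c p.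
Proof.
rewrite /fisher_field /fisher_sum linear_sum; apply: eq_bigr => F _.
by rewrite linearZ /= trmx_mul trmxK.
Qed.

Definition zero_sum (l : seq sample) : Prop :=
  forall p, \sum_(s <- l) sval s p = 0.

(** At the points of the chart [c], positivity of the remainder in any other
    chart follows from the inequality [T <= h / 2] in [c], and outside the chart
    nothing is subtracted. *)
Lemma global_round h c K (omega : R) : continuous_metric h -> atlas c ->
  compact K -> K `<=` chart_cod c -> 0 < omega ->
  exists l w, [/\ 0 < w /\ w * (size l)%:R = omega, zero_sum l,
    continuous_metric (fun c p => h c p - fisher_field w l c p) &
    forall p, chart_dom c p -> K (chart_map c p) -> forall v,
      1 / 64 * quad (h c p) v <= quad (fisher_field w l c p) v].
Proof.
move=> [hc ht hp] ac cK Kc omega0.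
have oc : open (chart_cod c) by exact: chart_cod_open.
have lhp y : chart_cod c y -> posdef (local h c y).
  by move=> /chart_invP[cy _]; exact: hp.
have [lF [w [K' [[w0 wl] [cK' K'c] [lP lS] ub lb]]]] :=
  local_round oc (hc c ac) lhp cK Kc omega0.
have sP F : F \in lF ->
    smooth_function (extend c F) /\ forall p, `|extend c F p| <= 1 / 2.
  move=> /lP[sF F1 F0]; split=> [|p]; first exact: smooth_extend F0.
  by rewrite /extend; case: pselect => cp; [exact: F1|rewrite normr0].
pose l : seq sample := pmap (fun F =>
  if pselect (smooth_function (extend c F) /\ forall p, `|extend c F p| <= 1 / 2)
  is left H then Some (exist _ (extend c F) H) else None) lF.
have lE : [seq sval s | s <- l] = [seq extend c F | F <- lF].
  rewrite /l; elim: (lF) sP => [//|F lF' IH] sP /=.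
  case: pselect => [H|[]]; last by apply: sP; rewrite mem_head.
  by rewrite /= IH// => G GlF; apply: sP; rewrite inE GlF orbT.
have bigE (T : nmodType) (G : (M -> R) -> T) :
    \sum_(s <- l) G (sval s) = \sum_(F <- lF) G (extend c F).
  by rewrite -(big_map (@sval _ _) xpredT G) lE big_map.
have sl : size l = size lF by rewrite -(size_map (@sval _ _)) lE size_map.
have TE p : chart_dom c p -> fisher_field w l c p = fisher_sum w lF (chart_map c p).
  move=> cp; rewrite fisher_fieldE// (bigE _ (fun s => (w / (1 + s p)) *:
    (chart_grad s c p *m (chart_grad s c p)^T))).
  by apply: eq_bigr => F _; rewrite extendE// chart_grad_extend.
have T2 c' p v : atlas c' -> chart_dom c' p ->
    quad (fisher_field w l c' p) v <= 1 / 2 * quad (h c' p) v.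
  move=> ac' cp'; have [cp|ncp] := pselect (chart_dom c p).
    rewrite (fisher_field_transition w l ac' ac cp' cp) (ht c' c)// !quad_congr.
    rewrite TE//; have xc : chart_cod c (chart_map c p) by exists p.
    by have := ub _ (v *m transition_jacobian c' c p) xc; rewrite /local chart_mapK.
  have -> : fisher_field w l c' p = 0.
    rewrite fisher_fieldE// (bigE _ (fun s => (w / (1 + s p)) *:
      (chart_grad s c' p *m (chart_grad s c' p)^T))) big_seq big1// => F /lP[_ _ F0].
    rewrite (@chart_grad_eq0 _ _ _ _ _ _ (~` (chart_inv c @` K'))) ?mul0mx ?scaler0//.
    - by rewrite openC; exact: chart_inv_closed.
    - move=> [y Ky yp]; apply: ncp; rewrite -yp.
      by have [] := chart_invP (K'c y Ky).
    - by move=> q; exact: extend_outside.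
  by rewrite quad0 mulr_ge0// posdef_ge0//; exact: hp.
exists l, w; split.
- by rewrite sl.
- move=> p; rewrite (bigE _ (fun s => s p)).
  have [cp|ncp] := pselect (chart_dom c p).
    by under eq_bigr do rewrite extendE//; exact: lS.
  by rewrite big1// => F _; rewrite /extend; case: pselect.
- split=> [c' ac' i j x xc'|c1 c2 p a1 a2 p1 p2|c' p ac' cp'].
  + rewrite (_ : (fun z => _) =
      fun z => local h c' z i j - local (fisher_field w l) c' z i j).
      by apply: continuousB; [exact: hc|exact: fisher_field_continuous].
    by apply/funext => z; rewrite /local !mxE.
  + rewrite (ht c1 c2)// (fisher_field_transition w l a1 a2 p1 p2).
    by rewrite mulmxBr mulmxBl.
  + have [hs h0] := hp c' p ac' cp'; split.
      by rewrite linearB /= hs fisher_field_sym.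
    move=> v v0; rewrite quadB; have := T2 c' p v ac' cp'; have := h0 v v0.
    lra.
- move=> p cp Kp v; rewrite TE//.
  by have := lb _ v Kp; rewrite /local chart_mapK.
Qed.

End GlobalRound.

(** * Exhausting a metric by countably many rounds *)

Section Exhaustion.
Variables (R : realType) (n : nat) (M : smoothManifold R n).
Implicit Types (c : chart R n M) (p : M) (h : field M n n).

Definition compact_in_chart (cK : chart R n M * set 'rV[R]_n) : Prop :=
  [/\ atlas cK.1, compact cK.2 & cK.2 `<=` chart_cod cK.1].

(** Each member of a countable basis that is contained in a compact subset of a
    chart is assigned one such compact set; the members of the basis are numbered
    by an injection [iota] into the natural numbers. *)
Lemma countable_compact_cover (p0 : M) :
  exists2 f : nat -> chart R n M * set 'rV[R]_n,
    (forall e, compact_in_chart (f e)) &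
    forall p, exists e, chart_dom (f e).1 p /\ (f e).2 (chart_map (f e).1 p).
Proof.
have [B cB [Bo Bb]] := @points_second_countable R n M.
have /countable_injP[iota iota_inj] := cB.
have [c0 a0 _] := atlas_cover p0.
have /choice[f Hf] : forall e : nat, exists cK, compact_in_chart cK /\
    forall b, B b -> iota b = e ->
      (exists cK', compact_in_chart cK' /\
        b `<=` [set p | chart_dom cK'.1 p /\ cK'.2 (chart_map cK'.1 p)]) ->
      b `<=` [set p | chart_dom cK.1 p /\ cK.2 (chart_map cK.1 p)].
  move=> e.
  have [[b [Bb' be [cK [icK bcK]]]]|nb] := pselect (exists b, [/\ B b, iota b = e &
      exists cK', compact_in_chart cK' /\
        b `<=` [set p | chart_dom cK'.1 p /\ cK'.2 (chart_map cK'.1 p)]]).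
    exists cK; split=> // b' Bb'' b'e _.
    suff -> : b' = b by [].
    by apply: iota_inj; rewrite ?inE// b'e be.
  exists (c0, set0); split.
    by split=> //=; exact: compact0.
  by move=> b Bb' be H; exfalso; apply: nb; exists b.
exists f => [e|p]; first by have [] := Hf e.
have [c ac cp] := atlas_cover p.
have xc : chart_cod c (chart_map c p) by exists p.
have nc : nbhs (chart_map c p) (chart_cod c).
  by apply: open_nbhs_nbhs; split => //; exact: chart_cod_open.
have [r /= r0 Hr] := (nbhs_ballP _ _).1 nc.
have r2 : 0 < r / 2 by rewrite divr_gt0.
pose K : set 'rV[R]_n := [set y | `|y - chart_map c p| <= r / 2].
have icK : compact_in_chart (c, K).
  split=> //=; first exact: closed_ball_compact.
  move=> y Ky; apply: Hr; rewrite -ball_normE /= distrC (le_lt_trans Ky)//.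
  by rewrite ltr_pdivrMr// ltr_pMr// ltr1n.
have nK : nbhs p [set q | chart_dom c q /\ K (chart_map c q)].
  apply: filterI; first by apply: open_nbhs_nbhs; split => //; exact: chart_dom_open.
  apply: (chart_map_continuous cp).
  apply: filterS (nbhsx_ballx (chart_map c p) _ r2) => y.
  by rewrite -ball_normE /= distrC => /ltW.
have [b [/= Bb' bp] bK] := Bb p _ nK.
exists (iota b); have [_ /(_ b Bb' erefl)] := Hf (iota b).
by apply => //; exists (c, K).
Qed.

Lemma logn2_infinite (e m : nat) : exists2 j, (m <= j)%N & logn 2 j.+1 = e.
Proof.
exists (2 ^ e * m.*2.+1).-1; last first.
  rewrite prednK ?muln_gt0 ?expn_gt0// lognM ?expn_gt0// pfactorK//.
  by rewrite lognE /= dvdn2 /= odd_double /= addn0.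
rewrite -ltnS prednK ?muln_gt0 ?expn_gt0//.
rewrite (@leq_trans m.*2.+1)// ?leq_pmull ?expn_gt0//.
by rewrite ltnS -addnn leq_addr.
Qed.

(** If the limit were positive, the next loss of a fixed proportion would bring
    the sequence below it. *)
Lemma cvg0_infinite_decay (a : nat -> R) :
  (forall j, 0 <= a j) -> (forall j, a j.+1 <= a j) ->
  (forall m, exists2 j, (m <= j)%N & a j.+1 <= 63 / 64 * a j) ->
  a @ \oo --> 0.
Proof.
move=> a0 adec ainf.
have ani : {homo a : n m / (n <= m)%N >-> m <= n}.
  by apply/nonincreasing_seqP.
have cva : cvgn a.
  by apply: nonincreasing_is_cvgn => //; exists 0 => _ [j _ <-].
have L0 : 0 <= limn a by apply: limr_ge => //; near=> j; exact: a0.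
suff <- : limn a = 0 by [].
apply/eqP; rewrite eq_le L0 andbT leNgt; apply/negP => Lpos.
have L64 : limn a < 64 / 63 * limn a by lra.
have [m _ Hm] := cvgr_lt _ cva _ L64.
have [j mj aj] := ainf m.
have := nonincreasing_cvgn_ge ani cva j.+1.
have := Hm j mj; lra.
Unshelve. all: by end_near. Qed.

Definition round_mass (j : nat) : R := 1 / (2 ^ (j + 1))%:R.

(** The round [j] treats the compact set number [logn 2 j.+1], a sequence that
    takes each value infinitely often. The partial sums are the differences
    [g - H j] with the remainders. *)
Lemma metric_exhaustion (p0 : M) g : continuous_metric g ->
  exists (l : nat -> seq (sample M)) (w : nat -> R), [/\
    forall j, 0 < w j /\ w j * (size (l j))%:R = round_mass j,
    forall j, zero_sum (l j) &
    forall c p, atlas c -> chart_dom c p -> forall v,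
      series (fun j => quad (fisher_field (w j) (l j) c p) v) @ \oo -->
      quad (g c p) v].
Proof.
move=> gm; have [f fK fcov] := countable_compact_cover p0.
have /choice[L HL] : forall hj : field M n n * nat,
  exists lw : seq (sample M) * R, continuous_metric hj.1 ->
  [/\ 0 < lw.2 /\ lw.2 * (size lw.1)%:R = round_mass hj.2, zero_sum lw.1,
    continuous_metric (fun c p => hj.1 c p - fisher_field lw.2 lw.1 c p) &
    let cK := f (logn 2 hj.2.+1) in
    forall p, chart_dom cK.1 p -> cK.2 (chart_map cK.1 p) -> forall v,
      1 / 64 * quad (hj.1 cK.1 p) v <= quad (fisher_field lw.2 lw.1 cK.1 p) v].
  move=> [h j]; have [hm|nhm] := pselect (continuous_metric h); last first.
    by exists ([::], 0) => /nhm.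
  have [ac cK Kc] := fK (logn 2 j.+1).
  have omega0 : 0 < round_mass j by rewrite divr_gt0// ltr0n expn_gt0.
  by have [l [w H]] := global_round hm ac cK Kc omega0; exists (l, w).
pose H := fix H (j : nat) : field M n n := if j is j'.+1 then
  (fun c p => H j' c p - fisher_field (L (H j', j')).2 (L (H j', j')).1 c p) else g.
have Hm j : continuous_metric (H j).
  by elim: j => //= j IH; have [] := HL (H j, j) IH.
exists (fun j => (L (H j, j)).1), (fun j => (L (H j, j)).2); split.
- by move=> j; have [] := HL (H j, j) (Hm j).
- by move=> j; have [] := HL (H j, j) (Hm j).
move=> c p ac cp v.
pose T j := quad (fisher_field (L (H j, j)).2 (L (H j, j)).1 c p) v.
pose a j := quad (H j c p) v.
have aS j : a j.+1 = a j - T j by rewrite /a /T /= quadB.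
have T0 j : 0 <= T j.
  rewrite /T fisher_fieldE// quad_sum sumr_ge0// => s _.
  rewrite quadZ quad_rank1 mulr_ge0 ?sqr_ge0//.
  have [[w0 _] _ _ _] := HL (H j, j) (Hm j).
  have [_ /(_ p)] := svalP s; rewrite ler_norml => /andP[s0 _].
  by rewrite divr_ge0 ?(ltW w0)//; lra.
have a0 j : 0 <= a j by have [_ _ hp] := Hm j; exact/posdef_ge0/hp.
have cva : a @ \oo --> 0.
  apply: cvg0_infinite_decay => // [j|m]; first by rewrite aS lerBlDr lerDl.
  have [e [ep eK]] := fcov p; have [j mj je] := logn2_infinite e m.
  exists j => //; rewrite aS.
  have [_ _ _] := HL (H j, j) (Hm j); rewrite /= je => /(_ p ep eK).
  have [ace _ _] := fK e.
  move=> /(_ (v *m transition_jacobian c (f e).1 p)).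
  rewrite -!quad_congr -fisher_field_transition//.
  have [_ ht _] := Hm j; rewrite -ht// -/(T j) -/(a j); lra.
have serE : series T = fun j => a 0%N - a j.
  apply/funext; elim => [|j IH]; first by rewrite /series /= big_geq// subrr.
  by rewrite seriesSr IH aS; ring.
rewrite [X in X @ _ --> _](_ : _ = series T)// serE.
rewrite -[quad (g c p) v]subr0; apply: cvgB => //; exact: cvg_cst.
Qed.

End Exhaustion.

(** * The statistical model *)

Section SampleSpace.
Variables (R : realType) (n : nat) (M : smoothManifold R n).

Lemma sample0_subproof :
  smooth_function (fun _ : M => 0 : R) /\ forall p : M, `|0 : R| <= 1 / 2.
Proof.
split=> [c ac|_]; last by rewrite normr0.
by apply: smooth_on_cst; exact: chart_cod_open.
Qed.

Definition sample0 : sample M := exist _ (fun _ => 0) sample0_subproof.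

HB.instance Definition _ := gen_eqMixin (sample M).
HB.instance Definition _ := gen_choiceMixin (sample M).
HB.instance Definition _ := isPointed.Build (sample M) sample0.
HB.instance Definition _ := @isMeasurable.Build default_measure_display
  (sample M) discrete_measurable discrete_measurable0
  discrete_measurableC discrete_measurableU.

Lemma sample_measurable_fun d (T : measurableType d) (D : set (sample M))
  (f : sample M -> T) : measurable_fun D f.
Proof. by []. Qed.

Variables (l : nat -> seq (sample M)) (w : nat -> {nonneg R}).

Let round_measure (j : nat) : {measure set (sample M) -> \bar R} :=
  mscale (w j) (msum (fun k => \d_(nth sample0 (l j) k)) (size (l j))).

Definition sample_measure : {measure set (sample M) -> \bar R} :=
  mseries round_measure 0.

Lemma integral_sample (f : sample M -> R) (v : R) : (forall s, 0 <= f s) ->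
  series (fun j => (w j)%:num * \sum_(s <- l j) f s) @ \oo --> v ->
  (\int[sample_measure]_s (f s)%:E = v%:E)%E.
Proof.
move=> f0 fv; have f0E s : setT s -> (0 <= (f s)%:E)%E by rewrite lee_fin.
have roundE j : (\int[round_measure j]_s (f s)%:E =
                 ((w j)%:num * \sum_(s <- l j) f s)%:E)%E.
  rewrite ge0_integral_mscale// ge0_integral_measure_sum//.
  rewrite EFinM; congr (_ * _)%E.
  rewrite (big_nth sample0) big_mkord -sumEFin; apply: eq_bigr => k _.
  by rewrite integral_dirac// diracT mul1e.
rewrite ge0_integral_measure_series//.
rewrite (@eq_eseriesr _ _ (fun j => ((w j)%:num * \sum_(s <- l j) f s)%:E))//.
apply/cvg_lim => //.
rewrite (_ : (fun k => _) =
  EFin \o series (fun j => (w j)%:num * \sum_(s <- l j) f s)).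
  exact: cvg_comp fv _.
by apply/funext => k; rewrite /= sumEFin.
Qed.

End SampleSpace.

(** * Fisher integrals *)

Section Model.
Variables (R : realType) (n : nat) (M : smoothManifold R n).

Definition density (t : M) (s : sample M) : R := 1 + sval s t.

Lemma density_gt0 t s : 0 < density t s.
Proof.
by have [_ /(_ t)] := svalP s; rewrite /density ler_norml => /andP[s0 _]; lra.
Qed.

Lemma smooth_density s : smooth_function (density ^~ s).
Proof.
move=> c ac; have oc : open (chart_cod c) by exact: chart_cod_open.
apply: smooth_expr_smooth => //.
apply: (@SmoothAdd _ _ _ (fun=> 1)); first exact: smooth_expr_cst.
by apply: SmoothBase; have [ss _] := svalP s; exact: ss.
Qed.

Lemma chart_partial_density c t i s : atlas c -> chart_dom c t ->
  differentiable (density ^~ s \o chart_inv c) (chart_map c t) /\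
  partial i (density ^~ s \o chart_inv c) (chart_map c t) =
  chart_grad (sval s) c t i 0.
Proof.
move=> ac ct; have xc : chart_cod c (chart_map c t) by exists t.
have [ss _] := svalP s; have ds := smooth_on_differentiable (ss c ac) xc.
split; first exact: smooth_on_differentiable (smooth_density s ac) xc.
rewrite (@partialD _ _ (fun=> 1))// /partial derive_cst add0r.
by rewrite mxE.
Qed.

Lemma chart_partial_ln c t i s : atlas c -> chart_dom c t ->
  chart_partial c i (fun u => ln (density u s)) t =
  chart_grad (sval s) c t i 0 / density t s.
Proof.
move=> ac ct; have [df pf] := chart_partial_density i s ac ct.
rewrite /chart_partial.
have dln : is_derive ((density ^~ s \o chart_inv c) (chart_map c t)) 1
    (@ln R) (density t s)^-1.
  by rewrite /= chart_mapK//; apply: is_derive1_ln; exact: density_gt0.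
by rewrite (partial_comp1 i dln df) pf mulrC.
Qed.

Lemma chart_partial_sqrt c t i s : atlas c -> chart_dom c t ->
  chart_partial c i (fun u => Num.sqrt (density u s)) t =
  chart_grad (sval s) c t i 0 / (2 * Num.sqrt (density t s)).
Proof.
move=> ac ct; have [df pf] := chart_partial_density i s ac ct.
rewrite /chart_partial.
have dsq : is_derive ((density ^~ s \o chart_inv c) (chart_map c t)) 1
    (@Num.sqrt R) (2 * Num.sqrt (density t s))^-1.
  by rewrite /= chart_mapK//; apply: is_derive1_sqrt; exact: density_gt0.
by rewrite (partial_comp1 i dsq df) pf mulrC.
Qed.

Definition fisher_integrand c t (i j : 'I_n) (s : sample M) : R :=
  chart_grad (sval s) c t i 0 * chart_grad (sval s) c t j 0 / density t s.

Lemma fisher_logE c t i j : atlas c -> chart_dom c t ->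
  fisher_log density c t i j =1 fisher_integrand c t i j.
Proof.
move=> ac ct s; rewrite /fisher_log !chart_partial_ln// /fisher_integrand.
by field; rewrite gt_eqF// density_gt0.
Qed.

Lemma fisher_sqrtE c t i j : atlas c -> chart_dom c t ->
  fisher_sqrt density c t i j =1 (fun s => 1 / 4 * fisher_integrand c t i j s).
Proof.
move=> ac ct s; rewrite /fisher_sqrt !chart_partial_sqrt// /fisher_integrand.
have d0 := density_gt0 t s.
have q0 : Num.sqrt (density t s) != 0 by rewrite gt_eqF// sqrtr_gt0.
rewrite -[in RHS](sqr_sqrtr (ltW d0)); by field.
Qed.

Definition fisher_quad c t (v : 'rV[R]_n) (s : sample M) : R :=
  (v *m chart_grad (sval s) c t) 0 0 ^+ 2 / density t s.

Lemma fisher_polarization c t i j s : fisher_integrand c t i j s =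
  1 / 2 * (fisher_quad c t (delta_mx 0 i + delta_mx 0 j) s -
           fisher_quad c t (delta_mx 0 i) s - fisher_quad c t (delta_mx 0 j) s).
Proof.
rewrite /fisher_quad /fisher_integrand mulmxDl -!rowE !mxE.
by field; rewrite gt_eqF// density_gt0.
Qed.

(** The diagonal integrals [fisher_quad] are series of nonnegative terms, given by
    [metric_exhaustion]; the others follow by polarization. *)
Theorem continuous_metric_fisher (g : field M n n) :
  continuous_metric g -> fisher_information_metric g.
Proof.
move=> gm.
(* On the empty manifold any measure will do. *)
have [[p0 _]|M0] := pselect (exists p : M, True); last first.
  exists default_measure_display, (sample M), mzero, density; split.
    split=> [t|t|t|s]; last exact: smooth_density.
    1,2,3: by exfalso; apply: M0; exists t.
  by move=> c t; exfalso; apply: M0; exists t.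
have [l [w' [lw l0 lg]]] := metric_exhaustion p0 gm.
pose w j : {nonneg R} := NngNum (ltW (lw j).1).
pose mu := sample_measure l w.
exists default_measure_display, (sample M), mu, density; split.
  split=> [t s|t|t|s]; [exact: density_gt0|exact: sample_measurable_fun| |
    exact: smooth_density].
  apply: integral_sample => [s|]; first exact/ltW/density_gt0.
  have -> : (fun j => (w j)%:num * \sum_(s <- l j) density t s) = round_mass R.
    apply/funext => j; rewrite -(lw j).2 /density big_split /= l0 addr0.
    by rewrite big_const_seq count_predT iter_addr_0.
  by have := cvg_geometric_series_half (1 : R) 0; rewrite expr0 divr1; exact.
move=> c t ac ct i j.
have quadE v : (\int[mu]_s (fisher_quad c t v s)%:E = (quad (g c t) v)%:E)%E.
  apply: integral_sample => [s|].
    by rewrite divr_ge0 ?sqr_ge0// ltW// density_gt0.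
  rewrite (_ : (fun k => _) = fun k => quad (fisher_field (w' k) (l k) c t) v).
    exact: lg.
  apply/funext => k; rewrite fisher_fieldE// quad_sum mulr_sumr /=.
  apply: eq_bigr => s _; rewrite quadZ quad_rank1 /fisher_quad /density.
  by rewrite -mulrA [X in w' k * X]mulrC.
have quad_integrable v : mu.-integrable setT (EFin \o fisher_quad c t v).
  apply/integrableP; split; first by [].

  under eq_integral => s _.
    rewrite /= ger0_norm; last first.
      by rewrite divr_ge0 ?sqr_ge0// ltW// density_gt0.
    over.
  by rewrite quadE ltry.
have gsym : g c t i j = g c t j i.
  by have [_ _ hp] := gm; have [gs _] := hp c t ac ct; rewrite -{1}gs mxE.
pose q := fisher_quad c t.
pose e (k : 'I_n) : 'rV[R]_n := delta_mx 0 k.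
have FE : EFin \o fisher_integrand c t i j = (fun s =>
    (1 / 2)%:E * ((EFin \o q (e i + e j)%R) s - (EFin \o q (e i)) s
      - (EFin \o q (e j)) s))%E.
  by apply/funext => s; rewrite /= fisher_polarization.
have I1 := integrableB measurableT (quad_integrable (e i + e j))
  (quad_integrable (e i)).
have I2 := integrableB measurableT I1 (quad_integrable (e j)).
have Fint : mu.-integrable setT (EFin \o fisher_integrand c t i j).
  by rewrite FE; exact: integrableZl.
have FI : (\int[mu]_s (fisher_integrand c t i j s)%:E = (g c t i j)%:E)%E.
  transitivity (\int[mu]_s ((EFin \o fisher_integrand c t i j) s))%E => //.
  rewrite FE integralZl// integralB// integralB//= !quadE -!EFinB -EFinM.
  congr EFin; rewrite /quad !bilDl !bilDr !bilE gsym; by field.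
have SE : EFin \o fisher_sqrt density c t i j =
    (fun s => (1 / 4)%:E * (EFin \o fisher_integrand c t i j) s)%E.
  by apply/funext => s; rewrite /= fisher_sqrtE.
have LE : EFin \o fisher_log density c t i j = EFin \o fisher_integrand c t i j.
  by apply/funext => s; rewrite /= fisher_logE.
split.
- by rewrite LE.
- by rewrite SE; exact: integrableZl.
- by rewrite -FI; apply: eq_integral => s _; rewrite fisher_logE.
- transitivity (4%:E * \int[mu]_s ((EFin \o fisher_sqrt density c t i j) s))%E => //.
  rewrite SE integralZl// FI -!EFinM; congr EFin; by field.
Qed.

End Model.

Theorem theorem1p4 (R : realType) :
  (forall (d : nat) (M : smoothManifold R (d * 2)) (g : field M (d * 2) (d * 2)),
     kahler_metric g -> fisher_information_metric g) /\
  (forall (d : nat) (M : smoothManifold R (1 + d * 2))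
          (g : field M (1 + d * 2) (1 + d * 2)),
     cokahler_metric g -> fisher_information_metric g).
Proof.
split=> d M g.
  move=> [w [J [_ _ _ [gR _] _]]].
  exact/continuous_metric_fisher/riemannian_continuous_metric.
move=> [W [a [E [A [_ _ [_ gR _] _]]]]].
exact/continuous_metric_fisher/riemannian_continuous_metric.
Qed.
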